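(* Let $f:(0,\infty)\to\mathbb{R}$ be a locally integrable function whose Laplace transform $F(z)=\int_0^\infty e^{-zx}f(x)\,dx$ is finite for all $z>0$, and let $f_n$ ($n\ge 1$) denote the Gaver-Stehfest approximations of $f$. Assume that $f$ is analytic in a neighborhood of a point $x_0>0$. Then there exists $c>0$ such that $$f_n(x_0)=f(x_0)+O(e^{-cn}),\qquad n\to+\infty.$$
   Context: The Gaver-Stehfest approximations of $f$ are defined, for $n\ge 1$ and $x>0$, by $$f_n(x):=\ln(2)\,x^{-1}\sum_{k=1}^{2n}a_k(n)\,F\left(k\ln(2)\,x^{-1}\right),$$ where $$a_k(n):=\frac{(-1)^{n+k}}{n!}\sum_{j=[(k+1)/2]}^{\min(k,n)}j^{n+1}\binom{n}{j}\binom{2j}{j}\binom{j}{k-j},\qquad 1\le k\le 2n,$$ and $[\cdot]$ denotes the integer part. *)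

(* Defs.v *)
From mathcomp Require Import all_boot all_order all_algebra.
From mathcomp Require Import all_classical all_reals all_analysis.
Set Implicit Arguments.
Unset Strict Implicit.
Unset Printing Implicit Defensive.
Import Order.TTheory GRing.Theory Num.Theory.
Import numFieldNormedType.Exports.
Local Open Scope classical_set_scope.
Local Open Scope ring_scope.

(* A function on (0, +oo) is represented by a total f : R -> R whose values
   outside (0, +oo) are not used.

   Lebesgue integral, in the extended reals. The library integral is
   \int f^+ - \int f^- with the convention +oo - +oo = -oo, so for a measurable
   f the value is finite iff x |-> e^(-zx) f(x) is absolutely integrable. *)
Definition laplace (R : realType) (f : R -> R) (z : R) : \bar R :=
  (\int[@lebesgue_measure R]_(x in `]0%R, +oo[) (expR (- (z * x)) * f x)%:E)%E.

(* All subtractions and halvings are on nat: n.+1./2 is the integer part of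
   (n+1)/2 and k - j is not truncated since j <= k; the powers j^(n+1) and the
   binomial coefficients are natural numbers, cast to R by %:R. *)
Definition stehfest_coef (R : realType) (n k : nat) : R :=
  (-1) ^+ (n + k) / (n`!)%:R *
  \sum_(k.+1./2 <= j < (minn k n).+1)
     (j ^ n.+1 * 'C(n, j) * 'C(2 * j, j) * 'C(j, k - j))%:R.

Definition gaver_stehfest (R : realType) (f : R -> R) (n : nat) (x : R) : R :=
  ln 2 * x^-1 *
  \sum_(1 <= k < (2 * n).+1)
     stehfest_coef R n k * fine (laplace f (k%:R * ln 2 * x^-1)).

Definition analytic_at (R : realType) (f : R -> R) (y : R) : Prop :=
  exists a : nat -> R, \forall x \near y, pseries a (x - y) @ \oo --> f x.

(* Main.v *)
Require Import Defs.
From mathcomp Require Import all_boot all_order all_algebra.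
From mathcomp Require Import all_classical all_reals all_analysis.
From mathcomp Require Import measurable_realfun ring lra zify.
Import Order.TTheory GRing.Theory Num.Theory.
Import numFieldNormedType.Exports.
From mathcomp.real_closed Require Import complex.
Import Normc.
Local Open Scope classical_set_scope.
Local Open Scope ring_scope.

(** Put lam = ln 2 / x0 and w = exp (- lam y), so that y = x0 is w = 1/2.
    Inserting the Laplace integral into the definition gives
      f_n (x0) = int_0^oo lam f(y) p_n(w) dy,  p_n(w) = sum_k a_k(n) w^k,
    and summing over k first shows that p_n(w) = q_n(v) with v = w (1 - w) and
      q_n(v) = (-1)^n / n! sum_j (-1)^j j^(n+1) C(n,j) C(2j,j) v^j.
    The theorem says that lam p_n(w) dy acts on functions analytic near x0 like
    the Dirac mass at x0, up to an exponentially small error.  At w = 1/2 the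
    variable v takes its maximum 1/4.  Three facts carry the proof.

    Localisation.  As C(2j,j) is the mean of (2 + 2 cos p)^j over the circle,
    q_n(v) is the mean of Q_n(v (2 + 2 cos p)), where
    Q_n(y) = (-1)^n / n! (y d/dy)^(n+1) (1 - y)^n.  With y = exp(-s) this is a
    derivative in s, that is, a coefficient in xi of a power of 1 - y exp(xi),
    and Cauchy's estimate applies.  On the circle |xi|^2 = r^2 = 1 - y^2
    the elementary bound [circle_bound]
      |1 - y exp(xi)|^2 <= r^2 - y (1 - y)^2 / 2
    makes Q_n(y) exponentially small away from y = 1, and of polynomial size
    on [0, 1].  Hence [stehfest_kernel_decay] and [stehfest_kernel_poly_bound].
    Cauchy's integral is replaced by the mean over the N-th roots of unity
    with N tending to infinity, so no contour integration is involved.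

    Exactness.  In the variable x = 1 - 2 w, the moment of x^l is an n-th
    finite difference of t^n R(t), with R the product of k factors
    (i + 1/2) / (t + i + 1/2) and k the upper half of l.  It equals 1 for
    l = 0, and is at most (4L)^n / n! for 0 < l <= L
    ([stehfest_moment_bound]).

    Approximation.  Since y = x0 - c ln (1 - x) with c = x0 / ln 2, the
    function f(y) is analytic in x near 0; [analytic_approx] provides
    polynomials of degree L in x with error O(L^2 2^-L) near 0, with value
    f(x0) at x = 0 and with l-th coefficient O(rho^-l).

    Replacing f by such a polynomial and taking L close to n / d for a large
    fixed d, every error is exponentially small: 2^-L beats the polynomial
    size of the kernel, the kernel decay beats rho^-L away from x = 0, and
    (4L)^n / n! <= (4 e L / n)^n beats rho^-L in the moments. *)

(** * Calculus inequalities *)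

Section Calculus.
Context {R : realType}.
Implicit Types (t x y T : R).

Lemma ge0_of_derive (g dg : R -> R) T t :
  (forall x, 0 <= x <= T -> is_derive x 1 g (dg x)) ->
  (forall x, 0 <= x <= T -> 0 <= dg x) ->
  0 <= g 0 -> 0 <= t <= T -> 0 <= g t.
Proof.
move=> gd dg0 g0 /andP[t0 tT].
have [||c /[!in_itv]/= /andP[c0 ct] gE] := @MVT_segment R g dg 0 t t0.
- move=> x /[!in_itv]/= /andP[x0 xt]; apply: gd.
  by rewrite (ltW x0) (le_trans (ltW xt) tT).
- apply: derivable_within_continuous => x /[!in_itv]/= /andP[x0 xt].
  by have [] := gd x; [rewrite x0 (le_trans xt tT)|].
have -> : g t = g 0 + dg c * (t - 0) by rewrite -gE; ring.
by rewrite addr_ge0 ?mulr_ge0 ?subr0// dg0// c0 (le_trans ct tT).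
Qed.

(** The common shape of every Taylor-type estimate below: a majorant of the
    derivative integrates to a majorant of the function. *)
Lemma bound_of_derive (g dg h dh : R -> R) T t :
  (forall x, 0 <= x <= T -> is_derive x 1 g (dg x)) ->
  (forall x, 0 <= x <= T -> is_derive x 1 h (dh x)) ->
  (forall x, 0 <= x <= T -> `|dg x| <= dh x) ->
  g 0 = 0 -> 0 <= h 0 -> 0 <= t <= T -> `|g t| <= h t.
Proof.
move=> gd hd dgh g0 h0 tT.
have H1 : 0 <= (h - g) t.
  apply: (@ge0_of_derive _ (fun x => dh x - dg x) T) => //.
  - by move=> x xT; have := gd x xT; have := hd x xT => *; exact: is_deriveB.
  - by move=> x /dgh; rewrite ler_norml => /andP[_]; rewrite subr_ge0.
  - by rewrite !fctE g0 subr0.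
have H2 : 0 <= (h + g) t.
  apply: (@ge0_of_derive _ (fun x => dh x + dg x) T) => //.
  - by move=> x xT; have := gd x xT; have := hd x xT => *; exact: is_deriveD.
  - move=> x /dgh; rewrite ler_norml => /andP[+ _].
    by rewrite -subr_ge0 opprK addrC.
  - by rewrite !fctE g0 addr0.
by move: H1 H2; rewrite !fctE ler_norml => H1 H2; apply/andP; split; lra.
Qed.

Lemma sin_le_id t : 0 <= t -> `|sin t| <= t.
Proof.
move=> t0; apply: (@bound_of_derive sin cos id (fun=> 1) t) => //.
- by move=> x _; exact: cos_max.
- exact: sin0.
- by rewrite t0 lexx.
Qed.

Lemma cos_ge_parabola x : 1 - x ^+ 2 / 2 <= cos x.
Proof.
suff H (t : R) : 0 <= t -> 1 - t ^+ 2 / 2 <= cos t.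
  by case: (ger0P x) => [/H//|xlt0]; rewrite -cosN -sqrrN H// oppr_ge0 ltW.
move=> t0; rewrite -subr_ge0.
apply: (@ge0_of_derive (cos - (fun z => 1 - z ^+ 2 / 2)) (fun z => z - sin z)
  t).
- move=> z _; apply: is_derive_eq; rewrite /GRing.scale/=; by field.
- by move=> z /andP[z0 _]; rewrite subr_ge0 (le_trans (ler_norm _)) ?sin_le_id.
- by rewrite !fctE cos0 expr0n/= mul0r subr0 subrr.
- by rewrite t0 lexx.
Qed.

(** The derivative of 2 - 2 cosh z (1 - z^2 / 2) is a sum of terms that are
    nonnegative for z >= 0, because z cosh z >= sinh z; the latter follows in
    the same way from z sinh z >= 0. *)
Lemma cosh_parabola x :
  (expR x + expR (- x)) * (1 - x ^+ 2 / 2) <= 2.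
Proof.
suff H (t : R) : 0 <= t -> (expR t + expR (- t)) * (1 - t ^+ 2 / 2) <= 2.
  case: (ger0P x) => [/H//|xlt0].
  by have := H (- x); rewrite sqrrN opprK addrC; apply; rewrite oppr_ge0 ltW.
move=> t0; rewrite -subr_ge0.
have sinh_ge0 (z : R) : 0 <= z -> 0 <= expR z - expR (- z).
  by move=> z0; rewrite subr_ge0 ler_expR; lra.
have sinh_le (z : R) : 0 <= z -> 0 <=
  z * (expR z + expR (- z)) - (expR z - expR (- z)).
  move=> z0.
  apply: (@ge0_of_derive (fun z =>
    z * (expR z + expR (- z)) - (expR z - expR (- z)))
     (fun z => z * (expR z - expR (- z))) z z).
  - move=> u _; apply: is_derive_eq; rewrite /GRing.scale/=; by field.
  - by move=> u /andP[u0 _]; rewrite mulr_ge0// sinh_ge0.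
  - by rewrite mul0r oppr0 subrr subr0.
  - by rewrite z0 lexx.
apply: (@ge0_of_derive (fun z => 2 - (expR z + expR (- z)) * (1 - z ^+ 2 / 2))
  (fun z => (z * (expR z + expR (- z)) - (expR z - expR (- z))) +
    (expR z - expR (- z)) * z ^+ 2 / 2) t t).
- move=> z _; apply: is_derive_eq; rewrite /GRing.scale/=; by field.
- move=> z /andP[z0 _]; rewrite addr_ge0 ?sinh_le//.
  by rewrite divr_ge0// mulr_ge0 ?sinh_ge0 ?sqr_ge0.
- by rewrite oppr0 expR0; lra.
- by rewrite t0 lexx.
Qed.
End Calculus.

(** * Averages of the exponential over roots of unity *)

Section RootsOfUnity.
Context {R : realType}.
Implicit Types (t x y : R) (N m i l : nat).

Definition angle N l : R := l%:R * (2 * pi / N%:R).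

Lemma cos_angle_period N l x : (0 < N)%N -> cos (x + N%:R * angle N l) = cos x.
Proof.
move=> N0; rewrite (_ : N%:R * angle N l = pi *+ 2 *+ l).
  by rewrite (periodicn (@cosD2pi R)).
by rewrite /angle -[RHS]mulr_natr -[X in _ = X * _]mulr_natr; field;
  rewrite pnatr_eq0 -lt0n.
Qed.

(** Multiplying by the sine of half the step turns the sum into a telescoping
    one over a full period. *)
Lemma sum_cos_angle N i : (0 < i < N)%N ->
  \sum_(l < N) cos (i%:R * angle N l) = 0 :> R.
Proof.
move=> /andP[i0 iN]; have N0 : (0 < N)%N by apply: leq_trans iN.
have N0' : N%:R != 0 :> R by rewrite pnatr_eq0 -lt0n.
set b : R := pi * i%:R / N%:R.
have sb : sin b != 0.
  rewrite gt_eqF// sin_gt0_pi//; apply/andP; split.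
    by rewrite divr_gt0 ?mulr_gt0 ?pi_gt0 ?ltr0n.
  by rewrite /b -mulrA gtr_pMr ?pi_gt0// ltr_pdivrMr ?ltr0n// mul1r ltr_nat.
apply: (mulfI sb); rewrite mulr0 mulr_sumr.
have E l : sin b * cos (i%:R * angle N l) =
    (sin (b + i%:R * angle N l) - sin (i%:R * angle N l - b)) / 2.
  by rewrite sinD sinB; field.
under eq_bigr do rewrite E.
rewrite -mulr_suml.
have -> : \sum_(l < N) (sin (b + i%:R * angle N l) - sin (i%:R * angle N l - b))
  =
  \sum_(0 <= l < N) (sin (i%:R * angle N l.+1 - b) -
    sin (i%:R * angle N l - b)).
  rewrite big_mkord; apply: eq_bigr => l _; congr (sin _ - _).
  by rewrite /angle /b -[l.+1%:R]natr1; field.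
rewrite telescope_sumr//.
have -> : i%:R * angle N N - b = - b + pi *+ 2 *+ i.
  by rewrite /angle -[pi *+ 2 *+ i]mulr_natr -[pi *+ 2]mulr_natr; field.
by rewrite (periodicn (@sinD2pi R)) /angle !mul0r mulr0 add0r subrr mul0r.
Qed.

(** Discrete counterpart of the contour integral of exp (t z) / z^(i+1) over
    the unit circle: the mean of the real part over the N-th roots of unity. As
    N grows it tends to the Taylor coefficient t^i / i!. *)
Definition exp_angle_avg N i t : R := N%:R^-1 *
  \sum_(l < N) expR (t * cos (angle N l)) * cos
    (t * sin (angle N l) - i%:R * angle N l).

(** Differentiating in t multiplies each term by the root of unity, which
    lowers the index. Together with the period N in the index this replaces the
    series expansion of the exponential. *)
Lemma is_derive_exp_angle_avg N i t :
  is_derive t 1 (exp_angle_avg N i.+1) (exp_angle_avg N i t).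
Proof.
rewrite /exp_angle_avg; apply: is_deriveZ.
rewrite (_ : (fun t => _) = \sum_(l < N) (fun t => expR (t * cos (angle N l)) *
   cos (t * sin (angle N l) - i.+1%:R * angle N l))); last first.
  by apply/funext => z; rewrite fct_sumE.
apply: is_derive_sum => l; apply: is_derive_eq; rewrite /GRing.scale/=.
rewrite (_ : t * sin (angle N l) - i%:R * angle N l =
 (t * sin (angle N l) - i.+1%:R * angle N l) + angle N l).
  by rewrite [in RHS]cosD; ring.
by rewrite -natr1; ring.
Qed.

Lemma exp_angle_avgD N i t : (0 < N)%N ->
  exp_angle_avg N (N + i) t = exp_angle_avg N i t.
Proof.
move=> N0; congr (_ * _); apply: eq_bigr => l _; congr (_ * _).
rewrite -[LHS](cos_angle_period N l _ N0) natrD; congr cos; ring.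
Qed.

Lemma exp_angle_avg_eq0 N i : (0 < i < N)%N -> exp_angle_avg N i 0 = 0.
Proof.
move=> iN; rewrite /exp_angle_avg;
  under eq_bigr do rewrite !mul0r expR0 mul1r sub0r cosN.
by rewrite sum_cos_angle// mulr0.
Qed.

Lemma exp_angle_avg00 N : (0 < N)%N -> exp_angle_avg N 0 0 = 1.
Proof.
move=> N0; rewrite /exp_angle_avg.
under eq_bigr do rewrite !mul0r expR0 mul1r subrr cos0.
by rewrite sumr_const card_ord mulVf// pnatr_eq0 -lt0n.
Qed.

Lemma norm_avg_le N (F : nat -> R) B : (0 < N)%N ->
  (forall l, `|F l| <= B) -> `|N%:R^-1 * \sum_(l < N) F l| <= B.
Proof.
move=> N0 FB; have Np : 0 < N%:R :> R by rewrite ltr0n.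
rewrite normrM ger0_norm ?invr_ge0 ?ler0n// mulrC ler_pdivrMr//.
apply: le_trans (ler_norm_sum _ _ _) _.
apply: (@le_trans _ _ (\sum_(l < N) B)); first by apply: ler_sum.
by rewrite sumr_const card_ord mulr_natr.
Qed.

Lemma norm_exp_angle_avg0 N t T : (0 < N)%N -> 0 <= t <= T ->
  `|exp_angle_avg N 0 t| <= expR T.
Proof.
move=> N0 /andP[t0 tT]; apply:
  (norm_avg_le N (fun l => expR (t * cos (angle N l)) *
  cos (t * sin (angle N l) - 0%:R * angle N l))) => // l.
rewrite normrM ger0_norm ?expR_ge0// -[leRHS]mulr1 ler_pM ?expR_ge0 ?cos_max//.
by rewrite ler_expR (le_trans _ tT)// ler_piMr// cos_le1.
Qed.

Lemma is_derive_pow_fact (c : R) i t :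
  is_derive t 1 (fun z => c * (z ^+ i.+1 / (i.+1)`!%:R))
    (c * (t ^+ i / i`!%:R)).
Proof.
have -> : (fun z => c * (z ^+ i.+1 / (i.+1)`!%:R)) =
    (c / (i.+1)`!%:R) \*: ((@id R) ^+ i.+1).
  by apply/funext => z; rewrite !fctE /GRing.scale/= mulrCA mulrC.
have := @is_deriveX R _ _ i.+1 _ _ _ (is_derive_id t (1 : R)) => D.
apply: is_derive_eq; rewrite /GRing.scale/= factS natrM.
by field; rewrite -(natrD _ 1) !pnatr_eq0 -lt0n fact_gt0.
Qed.

(** Taylor estimate by induction: below N all values at 0 vanish except that of
    index 0. *)
Lemma norm_exp_angle_avg_small N i t T : (i < N)%N -> 0 <= t <= T ->
  `|exp_angle_avg N i t| <= expR T * (t ^+ i / i`!%:R).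
Proof.
elim: i t => [|i IH] t iN tT.
  by rewrite expr0 fact0 divr1 mulr1 norm_exp_angle_avg0.
apply: (@bound_of_derive _ (exp_angle_avg N i.+1) (exp_angle_avg N i)
   (fun t => expR T * (t ^+ i.+1 / (i.+1)`!%:R))
   (fun t => expR T * (t ^+ i / i`!%:R)) T) => //.
- by move=> x _; exact: is_derive_exp_angle_avg.
- by move=> x _; exact: is_derive_pow_fact.
- by move=> x xT; apply: IH => //; exact: ltnW.
- by rewrite exp_angle_avg_eq0.
Qed.

(** Aliasing: the mean over N-th roots of unity only mixes the coefficient of
    index i with those of index i + N, i + 2N, and so on. The base case treats
    index 0 as index N and uses the previous estimate. *)
Lemma exp_angle_avg_approx N i t T : (i < N)%N -> 0 <= t <= T ->
  `|exp_angle_avg N i t - t ^+ i / i`!%:R| <=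
    expR T * (t ^+ (N + i) / (N + i)`!%:R).
Proof.
move=> iN; have N0 : (0 < N)%N by apply: leq_ltn_trans iN.
elim: i t iN => [|i IH] t iN tT.
  rewrite expr0 fact0 divr1 addn0.
  case: N N0 iN => // N N0 _.
  apply: (@bound_of_derive _ (fun t => exp_angle_avg N.+1 0 t - 1)
    (exp_angle_avg N.+1 N)
   (fun t => expR T * (t ^+ N.+1 / (N.+1)`!%:R))
   (fun t => expR T * (t ^+ N / N`!%:R)) T) => //.
  - move=> x _.
    have -> : (fun z => exp_angle_avg N.+1 0 z - 1) = exp_angle_avg N.+1 N.+1 -
      cst 1.
      by apply/funext => z; rewrite -(exp_angle_avgD _ 0)// addn0.
    rewrite -[exp_angle_avg N.+1 N x]subr0; apply: is_deriveB;
      exact: is_derive_exp_angle_avg.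
  - by move=> x _; exact: is_derive_pow_fact.
  - by move=> x xT; exact: norm_exp_angle_avg_small.
  - by rewrite exp_angle_avg00// subrr.
rewrite addnS -[t ^+ i.+1 / _]mul1r.
apply: (@bound_of_derive _
  (fun t => exp_angle_avg N i.+1 t - 1 * (t ^+ i.+1 / (i.+1)`!%:R))
   (fun t => exp_angle_avg N i t - 1 * (t ^+ i / i`!%:R))
   (fun t => expR T * (t ^+ (N + i).+1 / ((N + i).+1)`!%:R))
   (fun t => expR T * (t ^+ (N + i) / (N + i)`!%:R)) T) => //.
- move=> x _; have := is_derive_exp_angle_avg N i x => ?.
  by have := is_derive_pow_fact 1 i x => ?; apply: is_deriveB.
- by move=> x _; exact: is_derive_pow_fact.
- by move=> x xT; rewrite mul1r; apply: IH => //; exact: ltnW.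
- by rewrite exp_angle_avg_eq0// expr0n/= mul0r mulr0 subrr.
Qed.

Lemma cvg_exp_angle_avg i t : 0 <= t -> exp_angle_avg N i t @[N --> \oo] -->
  t ^+ i / i`!%:R.
Proof.
move=> t0; apply/subr_cvg0/norm_cvg0P.
apply: (@squeeze_cvgr _ _ _ _ (fun=> 0)
  (fun N => expR t * exp_coeff t (N + i))).
- near=> N; rewrite normr_ge0 exp_angle_avg_approx//; last by rewrite t0 lexx.
  by near: N; exists i.+1.
- exact: cvg_cst.
- rewrite -(mulr0 (expR t)); apply: cvgM; first exact: cvg_cst.
  by have := cvg_exp_coeff t; rewrite -(cvg_shiftn i).
Unshelve. all: by end_near. Qed.
End RootsOfUnity.

(** * A Cauchy estimate without contour integrals *)

Section Cauchy.
Local Open Scope complex_scope.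
Context {R : realType}.
Implicit Types (t x y a b r M : R) (N m n i l j : nat).

(** The complex number exp (a + i b), in coordinates. *)
Definition cexp a b : R[i] := (expR a * cos b) +i* (expR a * sin b).

Lemma cexpD a a' b b' : cexp (a + a') (b + b') = cexp a b * cexp a' b'.
Proof.
by apply/eqP; rewrite eq_complex/=; apply/andP; split;
  rewrite expRD ?cosD ?sinD; apply/eqP; ring.
Qed.

Lemma cexp0 : cexp 0 0 = 1.
Proof.
by apply/eqP; rewrite eq_complex/= expR0 cos0 sin0 mulr0 mulr1 !eqxx.
Qed.

Lemma cexpX a b n : cexp a b ^+ n = cexp (n%:R * a) (n%:R * b).
Proof.
elim: n => [|n IH]; first by rewrite !mul0r cexp0 expr0.
by rewrite exprS IH -cexpD -natr1; congr cexp; ring.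
Qed.

Lemma normc_cexp a b : normc (cexp a b) = expR a.
Proof.
rewrite /normc/= !exprMn -mulrDr cos2Dsin2 mulr1 sqrtr_sqr ger0_norm//.
Qed.

Lemma normcX (z : R[i]) n : normc (z ^+ n) = normc z ^+ n.
Proof.
by elim: n => [|n IH]; [rewrite !expr0 normc1 | rewrite !exprS normcM IH].
Qed.

Lemma normc_ge0 (z : R[i]) : 0 <= normc z.
Proof. by case: z => a b; rewrite /normc sqrtr_ge0. Qed.

Lemma Re_le_normc (z : R[i]) : `|Re z| <= normc z.
Proof.
case: z => a b /=; rewrite -sqrtr_sqr; apply: ler_wsqrtr.
by rewrite lerDl sqr_ge0.
Qed.

Lemma Re_real_mul a (z : R[i]) : Re (a%:C * z) = a * Re z.
Proof. by case: z => u v /=; rewrite mul0r subr0. Qed.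

Lemma Re_sum (I : Type) (s : seq I) (F : I -> R[i]) :
  Re (\sum_(i <- s) F i) = \sum_(i <- s) Re (F i).
Proof. by apply: (big_morph (@Re R)) => // -[a b] [c d]. Qed.

(** The right side is a combination of the terms averaged in [exp_angle_avg];
    the left side has a modulus that is easy to bound. *)
Lemma binomial_cexp m n y a b c :
  Re (cexp a b * (1 - y%:C * cexp a b) ^+ m * cexp 0 (- c)) =
  \sum_(j < m.+1) (- y) ^+ j * 'C(m, j)%:R *
     (expR (j.+1%:R * a) * cos (j.+1%:R * b - c)).
Proof.
rewrite exprDn mulr_sumr mulr_suml Re_sum; apply: eq_bigr => j _.
rewrite expr1n mul1r -mulNr exprMn cexpX -mulr_natr.
have -> : (- y%:C) ^+ j = ((- y) ^+ j)%:C :> R[i] by rewrite -rmorphN/=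
  rmorphXn.
have -> : ('C(m, j)%:R : R[i]) = ('C(m, j)%:R)%:C by rewrite rmorph_nat.
have -> (u v : R[i]) : cexp a b * (u * cexp (j%:R * a) (j%:R * b) * v) * cexp 0
  (- c) =
   u * (v * cexp (j.+1%:R * a) (j.+1%:R * b - c)).
  rewrite (_ : j.+1%:R * a = a + j%:R * a + 0); last by rewrite -natr1; ring.
  rewrite (_ : j.+1%:R * b = b + j%:R * b); last by rewrite -natr1; ring.
  by rewrite !cexpD; ring.
by rewrite !Re_real_mul mulrA.
Qed.

(** Cauchy estimate for the coefficient of xi^n in exp(xi) (1 - y exp(xi))^m on
    the circle of radius r: by the binomial theorem the coefficient is the sum
    on the left divided by n!, and the function is at most exp(r) M^m in
    modulus there. *)
Lemma exp_binomial_bound m n y r M : 0 <= r ->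
  (forall c, normc (1 - y%:C * cexp (r * cos c) (r * sin c)) <= M) ->
  `|\sum_(j < m.+1) (- y) ^+ j * 'C(m, j)%:R * (j.+1%:R) ^+ n| * r ^+ n / n`!%:R
    <= expR r * M ^+ m.
Proof.
move=> r0 HM.
pose S N := \sum_(j < m.+1) (- y) ^+ j * 'C(m, j)%:R * exp_angle_avg N n
  (j.+1%:R * r).
have SB N : (0 < N)%N -> `|S N| <= expR r * M ^+ m.
  move=> N0; pose c l := angle (R:=R) N l.
  have -> : S N = N%:R^-1 * \sum_(l < N) Re
    (cexp (r * cos (c l)) (r * sin (c l)) *
     (1 - y%:C * cexp (r * cos (c l)) (r * sin (c l))) ^+ m * cexp 0
       (- (n%:R * c l))).
    rewrite /S; under [in RHS]eq_bigr do rewrite binomial_cexp//.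
    rewrite exchange_big mulr_sumr/=; apply: eq_bigr => j _.
    rewrite /exp_angle_avg mulrCA; congr (_ * _); rewrite mulr_sumr;
      apply: eq_bigr => l _.
    by rewrite !mulrA.
  apply: (norm_avg_le N (fun l => Re (cexp (r * cos (c l)) (r * sin (c l)) *
     (1 - y%:C * cexp (r * cos (c l)) (r * sin (c l))) ^+ m * cexp 0
       (- (n%:R * c l))))) => // l.
  apply: (le_trans (Re_le_normc _)).
  rewrite !normcM normcX !normc_cexp expR0 mulr1 ler_pM ?expR_ge0 ?exprn_ge0
    ?normc_ge0//.
    by rewrite ler_expR ler_piMr// cos_le1.
  by rewrite lerXn2r ?nnegrE ?normc_ge0 ?HM//; apply: le_trans (HM 0);
    exact: normc_ge0.
have lim : S N @[N --> \oo] -->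
    \sum_(j < m.+1) (- y) ^+ j * 'C(m, j)%:R * ((j.+1%:R * r) ^+ n / n`!%:R).
  rewrite /S; apply: cvg_big => [|j _]; first exact: add_continuous.
  apply: cvgM; first exact: cvg_cst.
  by apply: cvg_exp_angle_avg; rewrite mulr_ge0.
rewrite (_ : _ / _ = `|\sum_(j < m.+1)
  (- y) ^+ j * 'C(m, j)%:R * ((j.+1%:R * r) ^+ n / n`!%:R)|); last first.
  have rn : 0 <= r ^+ n / n`!%:R by rewrite divr_ge0 ?exprn_ge0.
  rewrite -mulrA -[r ^+ n / _](ger0_norm rn) -normrM mulr_suml.
  by congr `| _ |; apply: eq_bigr => j _; rewrite exprMn !mulrA.
apply: (cvgr_to_le (cvg_norm lim)); exists 1%N => //; exact: SB.
Qed.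
End Cauchy.

(** * Bounds for the Euler-operator kernel *)

Section Circle.
Local Open Scope complex_scope.
Context {R : realType}.
Implicit Types (t x y a b r M : R) (N m n i l j : nat).

Lemma normc_sub_sq y a b :
  normc (1 - y%:C * cexp a b) ^+ 2 = 1 - 2 * y * expR a * cos b +
    y ^+ 2 * expR a ^+ 2.
Proof.
rewrite /cexp /normc/= sqr_sqrtr ?addr_ge0 ?sqr_ge0//.
have := cos2Dsin2 b; move: (cos b) (sin b) => u v uv.
transitivity (1 - 2 * y * expR a * u +
  y ^+ 2 * expR a ^+ 2 * (u ^+ 2 + v ^+ 2)); first by ring.
by rewrite uv mulr1.
Qed.

(** On the circle |xi| = r with r^2 = 1 - y^2 this says |1 - y exp(xi)| < r
    with an explicit gap. From cos b >= 1 - b^2/2 and cosh a <= 1 / (1 -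
    a^2/2), cos b / cosh a >= (1 - a^2/2) (1 - b^2/2) >= 1 - r^2/2, and 1 -
    r^2/2 = (1 + y^2) / 2 exceeds y by (1 - y)^2 / 2. *)
Lemma circle_bound y a b : 0 <= y <= 1 -> a ^+ 2 + b ^+ 2 = 1 - y ^+ 2 ->
  normc (1 - y%:C * cexp a b) ^+ 2 <= 1 - y ^+ 2 - y * (1 - y) ^+ 2 / 2.
Proof.
move=> /andP[y0 y1] ab; rewrite normc_sub_sq.
have := cosh_parabola a; have := cos_ge_parabola b.
have := expR_gt0 a; have := expRN a; move: (expR a) (expR (- a)) (cos b).
move=> E E' c -> E0 cb ch.
have {ch} H1 : (E ^+ 2 + 1) * (1 - a ^+ 2 / 2) <= 2 * E.
  have := ler_wpM2l (ltW E0) ch; rewrite [E * 2]mulrC; apply: le_trans.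
  by rewrite le_eqVlt; apply/orP; left; apply/eqP; field; rewrite gt_eqF.
have a2 : 0 <= a ^+ 2 by exact: sqr_ge0.
have b2 : 0 <= b ^+ 2 by exact: sqr_ge0.
have y2 : 0 <= y ^+ 2 by exact: sqr_ge0.
have E2 : 0 <= E ^+ 2 by exact: sqr_ge0.
have b1 : 0 <= 1 - b ^+ 2 / 2 by lra.
have H2 := ler_wpM2r b1 H1.
have H3 : E * (1 - b ^+ 2 / 2) <= E * c by rewrite ler_wpM2l// ltW.
have H4 : (E ^+ 2 + 1) * (1 - (a ^+ 2 + b ^+ 2) / 2) <=
    (E ^+ 2 + 1) * (1 - a ^+ 2 / 2) * (1 - b ^+ 2 / 2).
  rewrite -mulrA ler_wpM2l ?addr_ge0//.
  have : 0 <= a ^+ 2 * b ^+ 2 by exact: mulr_ge0.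
  lra.
rewrite ab in H4.
have H5 : 0 <= E ^+ 2 * (1 - y) ^+ 2 by rewrite mulr_ge0 ?sqr_ge0.
have H6 : y + y * E ^+ 2 + (1 - y) ^+ 2 / 2 <= 2 * (E * c) by lra.
have H7 := ler_wpM2l y0 H6.
lra.
Qed.

(** This is (-1)^n / n! times (y d/dy)^(n+1) applied to (1 - y)^n. *)
Definition euler_kernel n y : R := (-1) ^+ n / n`!%:R *
  \sum_(j < n.+1) (-1) ^+ j * (j%:R) ^+ n.+1 * 'C(n, j)%:R * y ^+ j.

(** One of the derivatives is carried out: it produces the factor y, needed for
    integrability at w = 0, and leaves a sum of the form bounded by
    [exp_binomial_bound]. *)
Lemma euler_kernelS n y : euler_kernel n.+1 y = (-1) ^+ n / n`!%:R * y *
  \sum_(i < n.+1) (- y) ^+ i * 'C(n, i)%:R * (i.+1%:R) ^+ n.+1.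
Proof.
rewrite /euler_kernel big_ord_recl/= expr0n/= mulr0 !mul0r add0r.
pose S := \sum_(i < n.+1) (- y) ^+ i * 'C(n, i)%:R * (i.+1%:R) ^+ n.+1 : R.
rewrite -/S.
transitivity ((-1) ^+ n.+1 / (n.+1)`!%:R * (- (n.+1%:R * y) * S)); last first.
  rewrite exprS factS natrM; field.
  by rewrite -(natrD _ 1) !pnatr_eq0 /= -lt0n fact_gt0.
congr (_ * _); rewrite mulr_sumr; apply: eq_bigr => i _.
rewrite /bump/= add1n [_.+1%:R ^+ n.+2]exprSr.
have H : i.+1%:R * 'C(n.+1, i.+1)%:R = n.+1%:R * 'C(n, i)%:R :> R.
  by rewrite -!natrM mul_bin_diag.
transitivity ((-1) ^+ i.+1 * i.+1%:R ^+ n.+1 * (i.+1%:R * 'C(n.+1, i.+1)%:R) * y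
  ^+ i.+1).
  by ring.
by rewrite H -[- y]mulN1r exprMn !exprS; ring.
Qed.

Lemma euler_kernel_circle_bound n y r M : 0 <= y -> 0 < r ->
  (forall c, normc (1 - y%:C * cexp (r * cos c) (r * sin c)) <= M) ->
  `|euler_kernel n.+1 y| <= n.+1%:R * y * (expR r * M ^+ n / r ^+ n.+1).
Proof.
move=> y0 r0 HM; have := exp_binomial_bound n n.+1 y r M (ltW r0) HM.
rewrite euler_kernelS.
set S := \sum_(i < n.+1) _ => {}HM.
have rn : 0 < r ^+ n.+1 by rewrite exprn_gt0.
have f0 : (0 : R) < n`!%:R by rewrite ltr0n fact_gt0.
rewrite !normrM normrX normrN1 expr1n mul1r normfV (ger0_norm y0)
  (ger0_norm (ltW f0)).
rewrite (_ : _ * y * `|S| =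
   n.+1%:R * y * (`|S| * r ^+ n.+1 / (n.+1)`!%:R / r ^+ n.+1)); last first.
  rewrite factS natrM; field.
  by rewrite -(natrD _ 1) !pnatr_eq0 /= -lt0n fact_gt0 (gt_eqF rn).
by rewrite ler_wpM2l ?mulr_ge0// ler_wpM2r// invr_ge0 ltW.
Qed.

Lemma circleE r (c : R) : (r * cos c) ^+ 2 + (r * sin c) ^+ 2 = r ^+ 2.
Proof. by rewrite !exprMn -mulrDr cos2Dsin2 mulr1. Qed.

Lemma expR_circle r (c : R) : 0 <= r -> expR (r * cos c) <= expR r.
Proof. by move=> r0; rewrite ler_expR ler_piMr// cos_le1. Qed.

Lemma normc_real_cexp y a b : 0 <= y -> normc (y%:C * cexp a b) = y * expR a.
Proof.
move=> y0; rewrite normcM normc_cexp; congr (_ * _).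
by rewrite /normc/= expr0n/= addr0 sqrtr_sqr ger0_norm.
Qed.

(** The radius sqrt (1 - y^2) gives the ratio M / r < 1 uniformly for y bounded
    away from 0 and from 1. Near y = 0 this ratio tends to 1, and the radius 2
    is used instead. *)
Lemma euler_kernel_decay (d : R) : 0 < d <= 1 -> exists th C : R,
  [/\ 0 < th < 1, 0 < C & forall n y, 0 <= y <= 1 - d ->
     `|euler_kernel n.+1 y| <= C * n.+1%:R * th ^+ n * y].
Proof.
move=> /andP[d0 d1].
(* y0 exp 2 = 1/2, so that 1 + y exp 2 <= 3/2 < 2 for y <= y0 *)
pose y0 : R := expR (- 2) / 2.
have y0_gt0 : 0 < y0 by rewrite divr_gt0 ?expR_gt0.
have y0_lt1 : y0 < 1.
  rewrite ltr_pdivrMr// mul1r; apply: (@le_lt_trans _ _ 1);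
    last by rewrite ltr1n.
  by rewrite -[leRHS]expR0 ler_expR; lra.
have y0d : 0 < y0 * d ^+ 2 <= 1.
  rewrite mulr_gt0 ?exprn_gt0//= mulr_ile1 ?(ltW y0_gt0) ?(ltW y0_lt1)
    ?sqr_ge0//.
  by rewrite exprn_ile1// ltW.
pose th1 := Num.sqrt (1 - y0 * d ^+ 2 / 2).
have th1_ge0 : 0 <= th1 by exact: sqrtr_ge0.
have th1_sq : th1 ^+ 2 = 1 - y0 * d ^+ 2 / 2 by rewrite sqr_sqrtr//; lra.
have th1_lt1 : th1 < 1.
  by rewrite -(@ltr_pXn2r _ 2) ?nnegrE// th1_sq expr1n; lra.
exists (Num.max (3 / 4) th1), (expR 2 / d); split.
- by rewrite lt_max gt_max th1_lt1; apply/andP; split;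
  [apply/orP; left|apply/andP; split=> //]; lra.
- by rewrite divr_gt0 ?expR_gt0.
move=> n y /andP[y_ge0 yd].
have [yy0|yy0] := leP y y0.
  apply: le_trans (euler_kernel_circle_bound n y 2 (3 / 2) y_ge0 _ _) _ => //.
    move=> c; apply: (le_trans (le_normcD _ _)).
    rewrite normcN normc1 normc_real_cexp//.
    have H : y * expR (2 * cos c) <= y0 * expR 2.
      by rewrite ler_pM ?expR_ge0// expR_circle.
    have : y0 * expR 2 = 1 / 2.
      by rewrite /y0 expRN; field; rewrite gt_eqF ?expR_gt0.
    lra.
  rewrite (_ : _ * y * _ = n.+1%:R * y * expR 2 * ((3 / 4) ^+ n * 2^-1));
    last first.
    rewrite (_ : 3 / 4 = 3 / 2 / 2); last by field.
    rewrite [(3 / 2 / 2) ^+ n]expr_div_n exprS; field.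
    by rewrite gt_eqF// exprn_gt0.
  rewrite (_ : expR 2 / d * _ * _ * y = n.+1%:R * y * expR
    2 * (Num.max (3 / 4) th1 ^+ n * d^-1)); last first.
    by field; rewrite gt_eqF.
  rewrite ler_wpM2l ?mulr_ge0 ?expR_ge0// ler_pM ?exprn_ge0 ?invr_ge0//.
    by rewrite lerXn2r ?nnegrE// ?le_max ?lexx//; lra.
  by rewrite lef_pV2 ?posrE//; lra.
have r2 : 0 < 1 - y ^+ 2 by nra.
pose r := Num.sqrt (1 - y ^+ 2).
have rsq : r ^+ 2 = 1 - y ^+ 2 by rewrite sqr_sqrtr// ltW.
have r_gt0 : 0 < r by rewrite sqrtr_gt0.
have r_le1 : r <= 1 by rewrite -(@ler_pXn2r _ 2) ?nnegrE ?(ltW r_gt0)// rsq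
  expr1n; nra.
have dr : d <= r by nra.
apply: le_trans (euler_kernel_circle_bound n y r (th1 * r) y_ge0 r_gt0 _) _ =>
  //.
  move=> c; rewrite -(@ler_pXn2r _ 2) ?nnegrE ?normc_ge0 ?mulr_ge0
    ?(ltW r_gt0)//.
  apply: le_trans (circle_bound y _ _ _ _) _; first by apply/andP; split=> //;
    lra.
    by rewrite circleE.
  rewrite exprMn th1_sq rsq.
  have H1 : d ^+ 2 <= (1 - y) ^+ 2 by rewrite lerXn2r ?nnegrE//; lra.
  have H2 : y0 * d ^+ 2 <= y * (1 - y) ^+ 2 by rewrite ler_pM ?sqr_ge0// ltW.
  have H3 : y0 * d ^+ 2 * (1 - y ^+ 2) <= y0 * d ^+ 2.
    by rewrite ler_piMr ?(ltW (andP y0d).1)//; nra.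
  lra.
rewrite (_ : _ * y * _ = n.+1%:R * y * th1 ^+ n * (expR r / r)); last first.
  by rewrite exprMn exprS; field; rewrite gt_eqF// gt_eqF// exprn_gt0.
rewrite (_ : expR 2 / d * _ * _ * y = n.+1%:R * y * Num.max (3 / 4)
  th1 ^+ n * (expR 2 / d)); last first.
  by field; rewrite gt_eqF.
apply: ler_pM; rewrite ?divr_ge0 ?mulr_ge0 ?exprn_ge0 ?expR_ge0 ?(ltW r_gt0)//.
  rewrite ler_wpM2l ?mulr_ge0// lerXn2r ?nnegrE ?le_max ?lexx ?orbT//.
  by apply/orP; left; lra.
apply: ler_pM; rewrite ?expR_ge0 ?invr_ge0 ?(ltW r_gt0)//.
  by rewrite ler_expR; lra.
by rewrite lef_pV2.
Qed.

(** As y tends to 1 the radius sqrt (1 - y^2) degenerates, and 1 / r is no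
    longer bounded. Below 1 / (n+1) it is frozen at that value, at the cost of
    a factor (1 + O(1/n))^n. *)
Lemma euler_kernel_poly_bound : exists2 C : R, 0 < C &
  forall n y, 0 <= y <= 1 -> `|euler_kernel n.+1 y| <= C * n.+1%:R ^+ 2 * y.
Proof.
exists (expR (1 + expR 1)); first exact: expR_gt0.
move=> n y /andP[y0 y1].
have n0 : (0 : R) < n.+1%:R by [].
pose s : R := n.+1%:R^-1.
have s0 : 0 < s by rewrite invr_gt0.
have s1 : s <= 1 by rewrite invf_le1// ler1n.
have [ys|ys] := leP (s ^+ 2) (1 - y ^+ 2).
  have r2 : 0 < 1 - y ^+ 2 by apply: lt_le_trans ys; rewrite exprn_gt0.
  pose r := Num.sqrt (1 - y ^+ 2).
  have rsq : r ^+ 2 = 1 - y ^+ 2 by rewrite sqr_sqrtr// ltW.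
  have r_gt0 : 0 < r by rewrite sqrtr_gt0.
  have r_le1 : r <= 1 by rewrite -(@ler_pXn2r _ 2) ?nnegrE ?(ltW r_gt0)// rsq
    expr1n gerBl sqr_ge0.
  have sr : s <= r by rewrite -(@ler_pXn2r _ 2) ?nnegrE ?(ltW r_gt0)
    ?(ltW s0)// rsq.
  apply: le_trans (euler_kernel_circle_bound n y r r y0 r_gt0 _) _ => //.
    move=> c; rewrite -(@ler_pXn2r _ 2) ?nnegrE ?normc_ge0 ?(ltW r_gt0)//.
    apply: le_trans (circle_bound y _ _ _ _) _; first by apply/andP; split.
      by rewrite circleE.
    by rewrite rsq gerBl divr_ge0// mulr_ge0// sqr_ge0.
  rewrite (_ : _ * y * _ = n.+1%:R * y * (expR r * r^-1)); last first.
    by rewrite exprS; field; rewrite gt_eqF// gt_eqF// exprn_gt0.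
  rewrite (_ : expR (1 + expR 1) * _ * y =
    n.+1%:R * y * (expR (1 + expR 1) * n.+1%:R)); last by ring.
  rewrite ler_wpM2l ?mulr_ge0// ler_pM ?expR_ge0 ?invr_ge0 ?(ltW r_gt0)//.
    by rewrite ler_expR (le_trans r_le1)// lerDl expR_ge0.
  by rewrite -[leRHS]invrK lef_pV2 ?posrE.
(* y' is the point whose own radius is s; moving from y' to y changes
   1 - y exp(xi) by at most (1 - y') exp s <= s^2 exp 1 *)
pose y' := Num.sqrt (1 - s ^+ 2).
have s2 : s ^+ 2 <= 1 by rewrite exprn_ile1// ltW.
have y'sq : y' ^+ 2 = 1 - s ^+ 2 by rewrite sqr_sqrtr// subr_ge0.
have y'0 : 0 <= y' by exact: sqrtr_ge0.
have y'1 : y' <= 1.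
  by rewrite -(@ler_pXn2r _ 2) ?nnegrE// y'sq expr1n gerBl sqr_ge0.
have y'y : y' <= y by rewrite -(@ler_pXn2r _ 2) ?nnegrE// y'sq; lra.
apply: le_trans (euler_kernel_circle_bound n y s (s * (1 + s * expR 1)) y0 s0 _)
  _ => //.
  move=> c; set z := cexp _ _.
  have -> : 1 - y%:C * z = (1 - y'%:C * z) - (y - y')%:C * z.
    by rewrite rmorphB/=; ring.
  apply: (le_trans (le_normcD _ _)); rewrite normcN normc_real_cexp ?subr_ge0//.
  rewrite mulrDr mulr1; apply: lerD.
    rewrite -(@ler_pXn2r _ 2) ?nnegrE ?normc_ge0 ?(ltW s0)//.
    apply: le_trans (circle_bound y' _ _ _ _) _; first by rewrite y'0.
      by rewrite circleE y'sq; ring.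
    have : 0 <= y' * (1 - y') ^+ 2 by rewrite mulr_ge0 ?sqr_ge0.
    lra.
  have H : y' ^+ 2 <= y' by rewrite expr2 ler_piMl.
  rewrite mulrA -expr2 ler_pM ?subr_ge0 ?expR_ge0//; first by lra.
  by apply: le_trans (expR_circle _ _ (ltW s0)) _; rewrite ler_expR.
rewrite (_ : _ * y * _ = n.+1%:R * y * (expR s * (1 + s * expR 1) ^+ n * s^-1));
  last first.
  by rewrite exprMn exprS; field; rewrite gt_eqF// gt_eqF// exprn_gt0.
rewrite (_ : expR (1 + expR 1) * _ * y =
  n.+1%:R * y * (expR 1 * expR (expR 1) * n.+1%:R)); last first.
  by rewrite expRD; ring.
rewrite invrK ler_wpM2l ?mulr_ge0// ler_wpM2r// ler_pM ?expR_ge0 ?ler_expR//.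
  by rewrite exprn_ge0// addr_ge0// mulr_ge0 ?expR_ge0// ltW.
apply: (@le_trans _ _ (expR (s * expR 1) ^+ n)).
  by rewrite lerXn2r ?nnegrE ?expR_ge0 ?expR_ge1Dx// addr_ge0// mulr_ge0
    ?expR_ge0// ltW.
rewrite -expRM_natl ler_expR mulrA ler_piMl ?expR_ge0//.
by rewrite ler_pdivrMr// mul1r ler_nat.
Qed.
End Circle.

(** * The Gaver-Stehfest kernel *)

Section Kernel.
Local Open Scope complex_scope.
Context {R : realType}.
Implicit Types (t x y a b r M w v : R) (N m n i l j k : nat).

Lemma sum_cos_angle_diff N k j : (k < N + j)%N -> (j < N + k)%N ->
  \sum_(l < N) cos (k%:R * angle N l - j%:R * angle N l) = (k == j)%:R * N%:R :>
    R.
Proof.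
move=> kN jN; case: ltngtP => kj.
- have -> : \sum_(l < N) cos (k%:R * angle N l - j%:R * angle N l) =
    \sum_(l < N) cos ((j - k)%:R * angle N l) :> R.
    by apply: eq_bigr => l _; rewrite -cosN natrB ?(ltnW kj)//; congr cos; ring.
  by rewrite sum_cos_angle ?mul0r//; lia.
- have -> : \sum_(l < N) cos (k%:R * angle N l - j%:R * angle N l) =
    \sum_(l < N) cos ((k - j)%:R * angle N l) :> R.
    by apply: eq_bigr => l _; rewrite natrB ?(ltnW kj)//; congr cos; ring.
  by rewrite sum_cos_angle ?mul0r//; lia.
- rewrite kj; under eq_bigr do rewrite subrr cos0.
  by rewrite sumr_const card_ord mul1r.
Qed.

(** 2 + 2 cos p = (1 + exp (i p))^2 exp (- i p), expanded by the binomial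
    theorem. *)
Lemma cos_pow_expand (p : R) j :
  (2 + 2 * cos p) ^+ j = \sum_(k < (2 * j).+1) 'C(2 * j, k)%:R * cos
    (k.+1%:R * p - j.+1%:R * p).
Proof.
have := @binomial_cexp R (2 * j) 0 (-1) 0 p (j.+1%:R * p).
under eq_bigr do rewrite opprK expr1n mul1r mulr0 expR0 mul1r.
move=> <-.
set z := cexp 0 p; pose z' := cexp 0 (- p).
have zz' : z * z' = 1 by rewrite -cexpD addr0 subrr cexp0.
have -> : cexp 0 (- (j.+1%:R * p)) = z' ^+ j.+1 by rewrite cexpX mulr0 mulrN.
have -> : z * (1 - (-1)%:C * z) ^+ (2 * j) * z' ^+ j.+1 =
    (z * z') * ((1 - (-1)%:C * z) ^+ 2 * z') ^+ j.
  by rewrite exprM [z' ^+ _]exprS mulrACA -exprMn.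
have -> : (1 - (-1)%:C * z) ^+ 2 * z' = (2 + 2 * cos p)%:C.
  transitivity (z' + 2 * (z * z') + z * (z * z')).
    by rewrite rmorphN rmorph1; ring.
  rewrite zz' !mulr1; apply/eqP; rewrite eq_complex/= expR0 cosN sinN.
  by apply/andP; split; apply/eqP; ring.
by rewrite zz' mul1r -rmorphXn.
Qed.

(** The central binomial coefficient is the constant term of (z + 2 + 1/z)^j;
    more than j roots of unity suffice to extract it exactly. *)
Lemma central_binom_avg N j : (j < N)%N ->
  'C(2 * j, j)%:R = N%:R^-1 * \sum_(l < N) (2 + 2 * cos (angle N l)) ^+ j :> R.
Proof.
move=> jN; have N0 : N%:R != 0 :> R by rewrite pnatr_eq0; lia.
under eq_bigr do rewrite cos_pow_expand.
rewrite exchange_big/=.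
have jj : (j < (2 * j).+1)%N by lia.
rewrite (bigD1 (Ordinal jj))//= [X in _ + X]big1 => [|k kj].
  rewrite -mulr_sumr sum_cos_angle_diff ?eqxx; [|lia|lia].
  by rewrite mul1r addr0; field.
rewrite -mulr_sumr sum_cos_angle_diff; [|have := ltn_ord k; lia|lia].
by rewrite (_ : (_ == _) = false) ?mul0r ?mulr0//; apply/negbTE; rewrite eqSS.
Qed.

(** The polynomial q_n in the variable v = w (1 - w). *)
Definition stehfest_kernel n v : R := (-1) ^+ n / n`!%:R *
  \sum_(j < n.+1) (-1) ^+ j * (j%:R) ^+ n.+1 * 'C(n, j)%:R *
    'C(2 * j, j)%:R * v ^+ j.

Lemma stehfest_kernel_avg n v : stehfest_kernel n v =
  n.+1%:R^-1 * \sum_(l < n.+1) euler_kernel n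
    (v * (2 + 2 * cos (angle n.+1 l))).
Proof.
rewrite /stehfest_kernel /euler_kernel -mulr_sumr exchange_big/= mulrCA;
  congr (_ * _).
rewrite mulr_sumr; apply: eq_bigr => j _.
rewrite (@central_binom_avg n.+1 j)// [_ * (_ * _)]mulrCA -!mulrA;
  congr (_ * _).
rewrite mulr_suml !mulr_sumr; apply: eq_bigr => l _.
by rewrite exprMn; ring.
Qed.

(** For fixed j, summing (-1)^k C(j,k-j) w^k over k gives (-1)^j (w (1 - w))^j;
    the summation bounds of the definition are those outside which the binomial
    vanishes, except that for k < j the truncated difference k - j would yield
    1. *)
Lemma sum_stehfest n w :
  \sum_(1 <= k < (2 * n).+1) stehfest_coef R n k * w ^+ k =
  stehfest_kernel n (w * (1 - w)).
Proof.
pose T k j : R := if (j <= k)%N then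
  (-1) ^+ (n + k) / n`!%:R *
  (j ^ n.+1 * 'C(n, j) * 'C(2 * j, j) * 'C(j, k - j))%:R * w ^+ k
  else 0.
have -> : \sum_(1 <= k < (2 * n).+1) stehfest_coef R n k * w ^+ k =
    \sum_(k < (2 * n).+1) \sum_(j < n.+1) T k j.
  rewrite -(big_mkord xpredT (fun k => \sum_(j < n.+1) T k j)).
  rewrite [RHS](big_cat_nat _ (n := 1))//= big_nat1.
  rewrite [X in _ = X + _]big1 ?add0r => [|j _]; last first.
    rewrite /T leqn0; case: eqP => // ->.
    by rewrite exp0n// !mul0n mulr0 mul0r.
  apply: eq_big_nat => k /andP[k1 k2].
  rewrite /stehfest_coef mulr_sumr mulr_suml.
  rewrite -(big_mkord xpredT (T k)).
  rewrite (@big_cat_nat _ _ _ (minn k n).+1 0 n.+1)//=; last by lia.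
  rewrite [X in _ = _ + X]big_nat_cond [X in _ = _ + X]big1 ?addr0; last first.
    by move=> j /andP[/andP[j1 j2] _]; rewrite /T ifF//; lia.
  rewrite (@big_cat_nat _ _ _ k.+1./2 0 (minn k n).+1)//=; last by lia.
  rewrite [X in _ = X + _]big_nat_cond [X in _ = X + _]big1 ?add0r; last first.
    move=> j /andP[/andP[j1 j2] _]; rewrite /T ifT; last by lia.
    by rewrite (@bin_small j (k - j)) ?muln0 ?mulr0 ?mul0r//; lia.
  by apply: eq_big_nat => j /andP[j1 j2]; rewrite /T ifT//; lia.
rewrite exchange_big/= /stehfest_kernel mulr_sumr; apply: eq_bigr => j _.
rewrite -(big_mkord xpredT (fun k => T k j)).
have jn := ltn_ord j.
rewrite (@big_cat_nat _ _ _ j 0 (2 * n).+1)//=; last by lia.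
rewrite big_nat_cond big1 ?add0r; last first.
  by move=> k /andP[/andP[k1 k2] _]; rewrite /T ifF//; lia.
rewrite (@big_cat_nat _ _ _ (j + j).+1 j (2 * n).+1)//=; [|lia|lia].
rewrite [X in _ + X]big_nat_cond [X in _ + X]big1 ?addr0; last first.
  move=> k /andP[/andP[k1 k2] _]; rewrite /T ifT; last by lia.
  by rewrite (@bin_small j (k - j)) ?muln0 ?mulr0 ?mul0r//; lia.
rewrite -[X in \sum_(X <= _ < _) _]add0n big_addn (_ : (j + j).+1 - j = j.+1)%N
  ?big_mkord; last by lia.
rewrite exprMn [(1 - w) ^+ j]exprDn !mulr_sumr; apply: eq_bigr => i _.
rewrite /T leq_addl addnK expr1n mul1r -mulr_natr !natrM natrX
  !exprD -[- w]mulN1r exprMn.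
ring.
Qed.

Lemma stehfest_kernel_decay (d : R) : 0 < d <= 1 -> exists th C : R,
  [/\ 0 < th < 1, 0 < C & forall n v, 0 <= v -> 4 * v <= 1 - d ->
     `|stehfest_kernel n.+1 v| <= C * n.+1%:R * th ^+ n * v].
Proof.
move=> /euler_kernel_decay[th [C [th01 C0 H]]].
exists th, (4 * C); split; rewrite ?mulr_gt0// => n v v0 vd.
rewrite stehfest_kernel_avg;
  apply: (norm_avg_le n.+2 (fun l =>
  euler_kernel n.+1 (v * (2 + 2 * cos (angle n.+2 l))))) => // l.
have c1 := cos_le1 (@angle R n.+2 l); have c2 := cos_geN1 (@angle R n.+2 l).
have H4 : v * (2 + 2 * cos (angle n.+2 l)) <= 4 * v.
  by rewrite mulrC ler_wpM2r//; lra.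
apply: (le_trans (H _ _ _)).
  by rewrite mulr_ge0//=; lra.
rewrite [leRHS](_ : _ = C * n.+1%:R * th ^+ n * (4 * v)); last by ring.
by rewrite ler_wpM2l// !mulr_ge0 ?exprn_ge0//; lra.
Qed.

Lemma stehfest_kernel_poly_bound : exists2 C : R, 0 < C &
  forall n v, 0 <= v -> 4 * v <= 1 ->
  `|stehfest_kernel n.+1 v| <= C * n.+1%:R ^+ 2 * v.
Proof.
have [C C0 H] := @euler_kernel_poly_bound R.
exists (4 * C); rewrite ?mulr_gt0// => n v v0 vd.
rewrite stehfest_kernel_avg;
  apply: (norm_avg_le n.+2 (fun l =>
  euler_kernel n.+1 (v * (2 + 2 * cos (angle n.+2 l))))) => // l.
have c1 := cos_le1 (@angle R n.+2 l); have c2 := cos_geN1 (@angle R n.+2 l).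
have H4 : v * (2 + 2 * cos (angle n.+2 l)) <= 4 * v.
  by rewrite mulrC ler_wpM2r//; lra.
apply: (le_trans (H _ _ _)).
  by rewrite mulr_ge0//=; lra.
rewrite [leRHS](_ : _ = C * n.+1%:R ^+ 2 * (4 * v)); last by ring.
by rewrite ler_wpM2l// !mulr_ge0 ?exprn_ge0//; lra.
Qed.
End Kernel.

(** * Moments of the kernel *)

Section Moments.
Context {R : realType}.
Implicit Types (P Q : {poly R}) (n i l j k a : nat).

(** The n-th finite difference of p at 0 with unit step, divided by n!, that
    is, its divided difference at 0, ..., n. *)
Definition fdiff n (p : R -> R) : R := (-1) ^+ n / n`!%:R *
  \sum_(j < n.+1) (-1) ^+ j * 'C(n, j)%:R * p j%:R.

(** Absorption j C(n+1,j) = (n+1) C(n,j-1), followed by the expansion of (1 +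
    j)^a. *)
Lemma alt_binom_sum_rec n a :
  \sum_(j < n.+2) (-1) ^+ j * 'C(n.+1, j)%:R * j%:R ^+ a.+1 =
  - n.+1%:R * \sum_(b < a.+1) 'C(a, b)%:R *
     \sum_(j < n.+1) (-1) ^+ j * 'C(n, j)%:R * j%:R ^+ b :> R.
Proof.
rewrite big_ord_recl/= expr0n/= mulr0 add0r.
under [in RHS]eq_bigr do rewrite mulr_sumr.
rewrite exchange_big/= mulr_sumr; apply: eq_bigr => j _.
rewrite /bump/= add1n.
have H : j.+1%:R * 'C(n.+1, j.+1)%:R = n.+1%:R * 'C(n, j)%:R :> R.
  by rewrite -!natrM mul_bin_diag.
transitivity ((-1) ^+ j.+1 * (j.+1%:R * 'C(n.+1, j.+1)%:R) * j.+1%:R ^+ a : R).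
  by rewrite [_ ^+ a.+1]exprS; ring.
rewrite H exprS -[j.+1%:R]nat1r [(1 + _) ^+ a]exprDn.
rewrite !mulr_sumr; apply: eq_bigr => b _.
by rewrite expr1n mul1r -mulr_natr; ring.
Qed.

Lemma fdiff_pow n a : (a <= n)%N -> fdiff n (fun x => x ^+ a) = (a == n)%:R.
Proof.
suff H : (a <= n)%N -> \sum_(j < n.+1) (-1) ^+ j * 'C(n, j)%:R * j%:R ^+ a =
   (a == n)%:R * ((-1) ^+ n * n`!%:R) :> R.
  move=> /H E; rewrite /fdiff E; case: eqP => _; last by rewrite !mul0r mulr0.
  rewrite !mul1r; transitivity (((-1) ^+ n) ^+ 2 : R);
    last by rewrite sqrr_sign.
  by field; rewrite pnatr_eq0 -lt0n fact_gt0.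
elim: n a => [|n IH] a; first by rewrite leqn0 => /eqP ->;
  rewrite big_ord1 /= !expr0 fact0 bin0 !mulr1.
case: a => [_|a an].
  rewrite mul0r; transitivity ((1 - 1) ^+ n.+1 : R);
    last by rewrite subrr expr0n.
  rewrite exprDn; apply: eq_bigr => j _.
  by rewrite expr1n expr0 mulr1 mul1r mulr_natr.
rewrite alt_binom_sum_rec.
rewrite (eq_bigr (fun b : 'I_a.+1 =>
  'C(a, b)%:R * ((nat_of_ord b == n)%:R * ((-1) ^+ n * n`!%:R)))); last first.
  by move=> b _; rewrite IH//; have := ltn_ord b; lia.
rewrite eqSS; have [->|an'] := eqVneq a n.
  rewrite big_ord_recr/= big1 ?add0r => [|b _].
    by rewrite eqxx binn !mul1r exprS factS natrM; ring.
  by rewrite (_ : (_ == _) = false) ?mul0r ?mulr0//; apply/negbTE; have :=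
    ltn_ord b; lia.
rewrite mul0r big1 ?mulr0// => b _.
by rewrite (_ : (_ == _) = false) ?mul0r ?mulr0//; apply/negbTE; have :=
  ltn_ord b; lia.
Qed.

Lemma fdiff_bound n (p : R -> R) : (forall j, `|p j%:R| <= 1) ->
  `|fdiff n p| <= 2 ^+ n / n`!%:R.
Proof.
move=> p1; rewrite /fdiff normrM normrM normrX normrN1 expr1n mul1r.
rewrite ger0_norm ?invr_ge0// mulrC ler_wpM2r ?invr_ge0//.
apply: (le_trans (ler_norm_sum _ _ _)).
have -> : 2 ^+ n = \sum_(j < n.+1) 'C(n, j)%:R :> R.
  transitivity ((1 + 1) ^+ n : R); first by [].
  by rewrite exprDn; apply: eq_bigr => j _; rewrite !expr1n mul1r.
apply: ler_sum => j _.
by rewrite !normrM normrX normrN1 expr1n mul1r ger0_norm// ler_piMr.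
Qed.

(** A ratio of Beta functions, B(l + 1/2, x) / B(1/2, x). *)
Definition half_ratio l (x : R) : R :=
  \prod_(i < l) ((i%:R + 2^-1) / (x + (i%:R + 2^-1))).

(** From x / (x + q) = 1 - q / (x + q), where q = l + 1/2. It trades a power of
    x in a finite difference for a factor at most l + 1. *)
Lemma half_ratio_rec l x : 0 <= x ->
  x * half_ratio l.+1 x = (l%:R + 2^-1) * (half_ratio l x - half_ratio l.+1 x).
Proof.
move=> x0; rewrite /half_ratio big_ord_recr/=; set r := \prod_(i < l) _.
have : 0 < x + (l%:R + 2^-1) by rewrite ltr_wpDl// ltr_wpDl//.
move=> d; field; rewrite gt_eqF//.
by rewrite (_ : _ + _ = 2 * (x + (l%:R + 2^-1))) ?mulr_gt0//; field.
Qed.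

Lemma half_ratio_bound l x : 0 <= x -> 0 <= half_ratio l x <= 1.
Proof.
move=> x0; rewrite /half_ratio; apply: (big_ind (fun z : R => 0 <= z <= 1)).
- by rewrite ler01 lexx.
- by move=> y z /andP[y0 y1] /andP[z0 z1]; rewrite mulr_ge0//= mulr_ile1.
- move=> i _; have i0 : (0 : R) < i%:R + 2^-1 by rewrite ltr_wpDl.
  have d : 0 < x + (i%:R + 2^-1) by rewrite ltr_wpDl.
  apply/andP; split; first by rewrite divr_ge0// ltW.
  by rewrite ler_pdivrMr// mul1r lerDr.
Qed.

Lemma eq_fdiff n p q : (forall j, p j%:R = q j%:R) -> fdiff n p = fdiff n q.
Proof. by move=> pq; congr (_ * _); apply: eq_bigr => j _; rewrite pq. Qed.

Lemma fdiff_lin n (c : R) p q :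
  fdiff n (fun x => c * (p x - q x)) = c * (fdiff n p - fdiff n q).
Proof.
rewrite /fdiff -mulrBr -sumrB mulrCA; congr (_ * _); rewrite mulr_sumr.
by apply: eq_bigr => j _; ring.
Qed.

(** Each use of [half_ratio_rec] removes a power of x and costs a factor 2L;
    when l drops to 0 the difference is that of a pure power of degree below n,
    which is zero. After all powers are removed the function is bounded by 1.
    *)
Lemma fdiff_half_ratio_bound n a l L : (a <= n)%N -> (0 < l <= L)%N ->
  `|fdiff n (fun x => x ^+ a * half_ratio l x)| <=
    (2 * L%:R) ^+ a * 2 ^+ n / n`!%:R.
Proof.
elim: a l => [|a IH] l an lL.
  rewrite expr0 mul1r; apply: fdiff_bound => j.
  by rewrite expr0 mul1r; have /andP[r0 r1] :=
    @half_ratio_bound l j%:R (ler0n _ _); rewrite ger0_norm.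
case: l lL => // l lL.
have -> : fdiff n (fun x => x ^+ a.+1 * half_ratio l.+1 x) =
  (l%:R + 2^-1) * (fdiff n (fun x => x ^+ a * half_ratio l x) -
    fdiff n (fun x => x ^+ a * half_ratio l.+1 x)).
  rewrite -fdiff_lin; apply: eq_fdiff => j.
  by rewrite exprSr -mulrA half_ratio_rec//; ring.
set B := (2 * L%:R) ^+ a * 2 ^+ n / n`!%:R in IH *.
have B0 : 0 <= B by rewrite /B divr_ge0// mulr_ge0 ?exprn_ge0// mulr_ge0.
have H1 : `|fdiff n (fun x => x ^+ a * half_ratio l x)| <= B.
  case: l lL => [|l] lL; last by apply: IH; lia.
  rewrite (_ : fdiff n _ = fdiff n (fun x => x ^+ a)).
    by rewrite fdiff_pow ?(ltnW an)// (_ : (_ == _) = false) ?normr0//; lia.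
  by apply: eq_fdiff => j; rewrite /half_ratio big_ord0 mulr1.
have H2 : `|fdiff n (fun x => x ^+ a * half_ratio l.+1 x)| <=
  B by apply: IH => //; lia.
have -> : (2 * L%:R) ^+ a.+1 * 2 ^+ n / n`!%:R = L%:R * (B + B) by rewrite /B
  exprS; ring.
rewrite normrM ler_pM//.
  rewrite ger0_norm; last by rewrite addr_ge0.
  by apply: (@le_trans _ _ l.+1%:R);
    [rewrite -[l.+1%:R]natr1; lra | rewrite ler_nat; lia].
by apply: (le_trans (ler_normB _ _)); rewrite lerD.
Qed.

(** The integral of P over [0, 1], computed on coefficients. *)
Definition int01 P : R := \sum_(i < size P) P`_i / i.+1%:R.

Lemma int01E N P : (size P <= N)%N -> int01 P = \sum_(i < N) P`_i / i.+1%:R.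
Proof.
move=> PN; rewrite /int01.
rewrite -(big_mkord xpredT (fun i => P`_i / i.+1%:R)).
rewrite -(big_mkord xpredT (fun i => P`_i / i.+1%:R)).
rewrite [RHS](big_cat_nat _ PN)//= [X in _ = _ + X]big_nat_cond.
rewrite [X in _ = _ + X]big1 ?addr0// => i /andP[/andP[Pi _] _].
by rewrite nth_default// mul0r.
Qed.

Lemma int01_lin (c : R) P Q : int01 (c *: P + Q) = c * int01 P + int01 Q.
Proof.
pose N := maxn (size P) (size Q).
rewrite (@int01E N P) ?leq_maxl// (@int01E N Q) ?leq_maxr// (@int01E N);
  last first.
  apply: (leq_trans (size_polyD _ _)); rewrite geq_max leq_maxr andbT.
  by apply: leq_trans (leq_maxl _ _); exact: size_scale_leq.
rewrite mulr_sumr -big_split; apply: eq_bigr => i _.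
by rewrite coefD coefZ/= mulrDl mulrA.
Qed.

Lemma int01_0 : int01 0 = 0.
Proof. by rewrite /int01 size_poly0 big_ord0. Qed.

Lemma int01Z (c : R) P : int01 (c *: P) = c * int01 P.
Proof. by have := int01_lin c P 0; rewrite addr0 int01_0 addr0. Qed.

Lemma int01D P Q : int01 (P + Q) = int01 P + int01 Q.
Proof. by have := int01_lin 1 P Q; rewrite scale1r mul1r. Qed.

Lemma int01_sum (I : Type) (r : seq I) (F : I -> {poly R}) :
  int01 (\sum_(i <- r) F i) = \sum_(i <- r) int01 (F i).
Proof. exact: (big_morph int01 int01D int01_0). Qed.

Lemma int01_deriv P : int01 P^`() = P.[1] - P.[0].
Proof.
have dP : (size P^`() <= size P)%N by apply: leq_trans (size_poly _ _)
  (leq_pred _).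
rewrite (int01E _ _ dP) horner_coef0 (@horner_coef_wide _ (size P).+1)//.
rewrite big_ord_recl/= expr0 mulr1 addrAC subrr add0r.
by apply: eq_bigr => i _; rewrite coef_deriv expr1n
  mulr1 -[P`_i.+1 *+ _]mulr_natr mulfK// pnatr_eq0.
Qed.

Definition vpoly : {poly R} := 'X * (1 - 'X).
Definition xpoly : {poly R} := 1 - 2 *: 'X.

(** The integral over [0, 1] of (1 - 2w)^l (w (1 - w))^i. *)
Definition beta_moment l i : R := int01 (xpoly ^+ l * vpoly ^+ i).

Lemma vpolyE : 4 *: vpoly = 1 - xpoly ^+ 2.
Proof. by rewrite /vpoly /xpoly -!mul_polyC !polyC_natr; ring. Qed.

Lemma deriv_vpoly : vpoly^`() = xpoly.
Proof.
rewrite /vpoly /xpoly derivM derivB derivX derivC -mul_polyC polyC_natr; ring.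
Qed.

Lemma deriv_xpoly : xpoly^`() = (- 2)%:P.
Proof.
by rewrite /xpoly derivB derivC derivZ derivX sub0r -mul_polyC mulr1 polyCN.
Qed.

Lemma vpoly_end i : (vpoly ^+ i.+1).[1] = 0 /\ (vpoly ^+ i.+1).[0] = 0.
Proof.
by split; rewrite horner_exp /vpoly !hornerE ?subrr ?mulr0 ?mul0r expr0n.
Qed.

Lemma beta_moment1 i : beta_moment 1 i = 0.
Proof.
have := int01_deriv (vpoly ^+ i.+1).
have [-> ->] := vpoly_end i; rewrite subrr deriv_exp deriv_vpoly/=.
rewrite -scaler_nat int01Z => /eqP; rewrite mulf_eq0 pnatr_eq0/= => /eqP.
by rewrite /beta_moment expr1.
Qed.

(** The derivative of (1 - 2w)^(l+1) (w (1 - w))^(i+1) has zero integral over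
    [0, 1]. *)
Lemma beta_moment_deriv l i :
  2 * l.+1%:R * beta_moment l i.+1 = i.+1%:R * beta_moment l.+2 i.
Proof.
have := int01_deriv (xpoly ^+ l.+1 * vpoly ^+ i.+1).
have [e1 e2] := vpoly_end i; rewrite !hornerM e1 e2 !mulr0 subrr.
rewrite derivM !deriv_exp deriv_vpoly deriv_xpoly/=.
rewrite (_ : _ + _ = (- 2 * l.+1%:R) *: (xpoly ^+ l * vpoly ^+ i.+1) +
   i.+1%:R *: (xpoly ^+ l.+2 * vpoly ^+ i)); last first.
  rewrite mulrnAl [X in _ + X]mulrnAr -[X in X + _]scaler_nat -[X in _ +
    X]scaler_nat.
  by rewrite mul_polyC -scalerAl scalerA [-2 * _]mulrC mulrA -exprSr.
rewrite int01_lin int01Z -/(beta_moment _ _) -/(beta_moment _ _); lra.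
Qed.

Lemma beta_moment_split l i :
  4 * beta_moment l i.+1 = beta_moment l i - beta_moment l.+2 i.
Proof.
rewrite /beta_moment -int01Z exprS scalerAr scalerAl vpolyE.
rewrite (_ : _ * _ = (-1) *:
  (xpoly ^+ l.+2 * vpoly ^+ i) + xpoly ^+ l * vpoly ^+ i).
  by rewrite int01_lin mulN1r addrC.
by rewrite scaleN1r !exprS; ring.
Qed.

Lemma beta_moment_rec l i :
  (2 * i%:R + l%:R + 3) * beta_moment l.+2 i = l.+1%:R * beta_moment l i.
Proof.
have := beta_moment_deriv l i; have := beta_moment_split l i => H1 H2.
have : 2 * l.+1%:R * (4 * beta_moment l i.+1) =
  4 * (i.+1%:R * beta_moment l.+2 i).
  by rewrite -H2; ring.
rewrite H1 -![_.+1%:R]natr1; lra.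
Qed.

Lemma beta_moment_odd l i : odd l -> beta_moment l i = 0.
Proof.
elim: l {-2}l (leqnn l) => [|m IH] l; first by rewrite leqn0 => /eqP ->.
case: l => [|[|l]]// lm ol; first exact: beta_moment1.
have := beta_moment_rec l i; rewrite (IH l) ?mulr0;
  [|lia|by move: ol; rewrite /= negbK].
move/eqP; rewrite mulf_eq0 => /orP[|/eqP//].
by rewrite gt_eqF// ltr_wpDl.
Qed.

(** This cancellation of C(2j,j) against the Beta integral is what turns
    moments of the kernel into finite differences of nearly polynomial
    functions. *)
Lemma central_binom_beta_moment i :
  'C(2 * i.+1, i.+1)%:R * beta_moment 0 i = 2 / i.+1%:R.
Proof.
elim: i => [|i IH].
  rewrite /beta_moment !expr0 mulr1 /int01 size_poly1 big_ord1 coef1/=.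
  by rewrite divr1 (_ : 'C(2 * 1, 1) = 2%N)// ; field.
have H1 := beta_moment_split 0 i; have H2 := beta_moment_rec 0 i.
have i1 : (2 * i%:R + 3 : R) != 0 by rewrite gt_eqF// ltr_wpDl.
have {H1 H2} E : beta_moment 0 i.+1 = beta_moment 0
  i * (i.+1%:R / (2 * (2 * i%:R + 3))).
  have E2 : beta_moment 2 i = beta_moment 0 i / (2 * i%:R + 3).
    by apply: (mulfI i1); rewrite -[in RHS]mulrC divfK// -[RHS]mul1r -H2 addr0.
  apply: (mulfI (_ : 4 != 0 :> R)) => //; rewrite H1 E2 -[i.+1%:R]natr1; field.
  by rewrite i1.
rewrite E mulrA.
have B : i.+2%:R * 'C(2 * i.+2, i.+2)%:R = 2 * (2 * i%:R + 3) * 'C(2 * i.+1,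
  i.+1)%:R :> R.
  have B1 : (i.+2 * 'C(2 * i.+2, i.+2) = 2 * i.+2 * 'C((2 * i.+1).+1, i.+1))%N.
    have -> : (2 * i.+2 = (2 * i.+1).+2)%N by lia.
    by rewrite mul_bin_diag.
  have B2 : (i.+2 * 'C((2 * i.+1).+1, i.+2) = (2 * i.+1).+1 * 'C(2 * i.+1,
    i.+1))%N.
    by rewrite mul_bin_diag.
  have B3 : ('C((2 * i.+1).+1, i.+2) = 'C((2 * i.+1).+1, i.+1))%N.
    by rewrite -bin_sub; [congr 'C(_, _)|]; lia.
  have -> : 2 * (2 * i%:R + 3) = (2 * (2 * i.+1).+1)%:R :> R.
    by rewrite natrM -[(2 * i.+1).+1%:R]natr1 natrM -[i.+1%:R]natr1; ring.
  by rewrite -!natrM; congr (_%:R); rewrite B1 -[RHS]mulnA -B2 B3 mulnA.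
have i2 : (i.+2%:R : R) != 0 by [].
apply: (mulfI i2); rewrite !mulrA B.
transitivity (2 * (2 * i%:R + 3) * ('C(2 * i.+1, i.+1)%:R * beta_moment 0 i) *
  (i.+1%:R / (2 * (2 * i%:R + 3)))); first by rewrite !mulrA.
by rewrite IH; field; rewrite i1 -(natrD _ 1) -(natrD _ 2) !pnatr_eq0.
Qed.

Lemma beta_moment_even l i :
  beta_moment (2 * l) i = beta_moment 0 i * half_ratio l i.+1%:R.
Proof.
elim: l => [|l IH]; first by rewrite muln0 /half_ratio big_ord0 mulr1.
have -> : half_ratio l.+1 i.+1%:R = half_ratio l
  i.+1%:R * ((l%:R + 2^-1) / (i.+1%:R + (l%:R + 2^-1))).
  by rewrite /half_ratio big_ord_recr.
rewrite mulrA -IH mulnS.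
have := beta_moment_rec (2 * l) i; rewrite -natr1 natrM -[i.+1%:R]natr1 => H.
have d : (2 * i%:R + 2 * l%:R + 3 : R) != 0
  by rewrite gt_eqF// ltr_wpDl// addr_ge0.
apply: (mulfI d); rewrite H; field.
by rewrite (_ : _ + _ = 2 * i%:R + 2 * l%:R + 3)//; ring.
Qed.

Definition stehfest_kernel_coef n j : R := (-1) ^+ n / n`!%:R *
  ((-1) ^+ j * (j%:R) ^+ n.+1 * 'C(n, j)%:R * 'C(2 * j, j)%:R).

(** p_n(w) / w as a polynomial in w: the missing factor w comes from dw = - lam
    w dy. *)
Definition stehfest_poly n : {poly R} :=
  (1 - 'X) * \sum_(j < n) stehfest_kernel_coef n j.+1 *: vpoly ^+ j.

(** Write 1 - w = (1 + x) / 2 with x = 1 - 2w; odd powers of x integrate to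
    zero by the symmetry w -> 1 - w, so x^l contributes through the even
    exponent l or l + 1. *)
Lemma stehfest_moment n l : (0 < n)%N ->
  int01 (xpoly ^+ l * stehfest_poly n) = fdiff n
    (fun x => x ^+ n * half_ratio (uphalf l) x).
Proof.
move=> n0.
transitivity (\sum_(j < n) stehfest_kernel_coef n
  j.+1 * (2^-1 * (beta_moment l j + beta_moment l.+1 j))).
  rewrite /stehfest_poly mulrA mulr_sumr int01_sum; apply: eq_bigr => j _.
  rewrite -scalerAr int01Z /beta_moment -int01D -[2^-1 * _]int01Z;
    congr (_ * int01 _).
  rewrite exprS -mul_polyC.
  have -> : 1 - 'X = (2^-1)%:P * (1 + xpoly).
    have H : (2^-1)%:P * 2 = 1 :> {poly R} by rewrite -polyC_natr -polyCM mulVf.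
    have -> : 1 - 'X = (2^-1)%:P * 2 * (1 - 'X) :> {poly R} by rewrite H mul1r.
    by rewrite /xpoly -mul_polyC polyC_natr; ring.
  ring.
transitivity (\sum_(j < n) stehfest_kernel_coef n
  j.+1 * (2^-1 * (beta_moment 0 j * half_ratio (uphalf l) j.+1%:R))).
  apply: eq_bigr => j _; rewrite -beta_moment_even; congr (_ * (_ * _)).
  rewrite uphalf_half; case: (boolP (odd l)) => ol.
    rewrite (beta_moment_odd _ _ ol) add0r; congr (beta_moment _ _).
    by have := odd_double_half l; rewrite ol; lia.
  rewrite [beta_moment l.+1 _]beta_moment_odd//= addr0; congr (beta_moment _ _).
  by have := odd_double_half l; rewrite (negbTE ol); lia.
rewrite /fdiff big_ord_recl/= expr0n gtn_eqF//= mul0r mulr0 add0r mulr_sumr.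
apply: eq_bigr => j _; rewrite /bump/= add1n /stehfest_kernel_coef.
transitivity ((-1) ^+ n / n`!%:R
  * ((-1) ^+ j.+1 * j.+1%:R ^+ n.+1 * 'C(n, j.+1)%:R *
   2^-1 * half_ratio (uphalf l) j.+1%:R) * ('C(2 * j.+1, j.+1)%:R * beta_moment
     0 j)); first by ring.
rewrite central_binom_beta_moment [j.+1%:R ^+ n.+1]exprS; field.
by rewrite pnatr_eq0 -lt0n fact_gt0 -(natrD _ 1) pnatr_eq0.
Qed.

Lemma stehfest_moment0 n : (0 < n)%N -> int01 (stehfest_poly n) = 1.
Proof.
move=> n0; have := stehfest_moment n 0 n0; rewrite expr0 mul1r => ->.
transitivity (fdiff n (fun x => x ^+ n)); last by rewrite fdiff_pow// eqxx.
by apply: eq_fdiff => j; rewrite /half_ratio big_ord0 mulr1.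
Qed.

Lemma stehfest_moment_bound n l L : (0 < n)%N -> (0 < l <= L)%N ->
  `|int01 (xpoly ^+ l * stehfest_poly n)| <= (4 * L%:R) ^+ n / n`!%:R.
Proof.
move=> n0 /andP[l0 lL]; rewrite stehfest_moment//.
have -> : (4 * L%:R) ^+ n = (2 * L%:R) ^+ n * 2 ^+ n :> R.
  by rewrite -exprMn; congr (_ ^+ _); ring.
by apply: fdiff_half_ratio_bound => //; rewrite uphalf_half; have :=
  odd_double_half l; lia.
Qed.

Lemma horner_stehfest_poly n w : (0 < n)%N ->
  w * (stehfest_poly n).[w] = stehfest_kernel n (w * (1 - w)).
Proof.
move=> n0; rewrite /stehfest_poly /stehfest_kernel big_ord_recl expr0n/= mulr0
  !mul0r add0r.
rewrite hornerM mulrA (_ : (1 - _).[w] = 1 - w) ?horner_sum;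
  last by rewrite !hornerE.
rewrite !mulr_sumr; apply: eq_bigr => j _.
rewrite /bump/= add1n hornerZ horner_exp /vpoly /stehfest_kernel_coef
  [(w * (1 - w)) ^+ _]exprS.
by rewrite hornerM hornerD hornerN hornerX hornerC; ring.
Qed.
End Moments.

(** * Polynomial approximation near the evaluation point *)

Section Approx.
Context {R : realType}.
Implicit Types (P Q T : {poly R}) (x t u rho c : R) (N L i l j k m : nat).

Lemma geo_sum N x : (1 - x) * \sum_(i < N) x ^+ i = 1 - x ^+ N.
Proof. by rewrite -[RHS]opprB subrX1 -mulNr opprB. Qed.

Lemma geo_sum_le2 N x : 0 <= x <= 1 / 2 -> \sum_(i < N) x ^+ i <= 2.
Proof.
move=> /andP[x0 x1]; have := geo_sum N x; have : 0 <=
  x ^+ N by rewrite exprn_ge0.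
have S0 : 0 <= \sum_(i < N) x ^+ i by rewrite sumr_ge0// => i _;
  rewrite exprn_ge0.
nra.
Qed.

(** Partial sums of the series of - ln (1 - x). *)
Definition lnpoly N : {poly R} := \sum_(i < N) i.+1%:R^-1 *: 'X^(i.+1).

Lemma horner_lnpoly N x : (lnpoly N).[x] = \sum_(i < N) i.+1%:R^-1 * x ^+ i.+1.
Proof.
by rewrite horner_sum; apply: eq_bigr => i _; rewrite hornerZ hornerXn.
Qed.

Lemma deriv_lnpoly N x : ((lnpoly N)^`()).[x] = \sum_(i < N) x ^+ i.
Proof.
rewrite /lnpoly (big_morph _ (@derivD R) (derivC 0)) horner_sum;
  apply: eq_bigr => i _.
by rewrite derivZ derivXn hornerZ hornerMn hornerXn/=
  mulrnAr -mulrnAl -[i.+1%:R^-1 *+ _]mulr_natr mulVf// mul1r.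
Qed.

Lemma norm_lnpoly N x : `|x| <= 1 / 2 -> `|(lnpoly N).[x]| <= 2 * `|x|.
Proof.
move=> x1; rewrite horner_lnpoly; apply: (le_trans (ler_norm_sum _ _ _)).
apply: (@le_trans _ _ (`|x| * \sum_(i < N) `|x| ^+ i)).
  rewrite mulr_sumr; apply: ler_sum => i _.
  rewrite normrM normrX exprS ler_piMl ?mulr_ge0 ?exprn_ge0//.
  by rewrite ger0_norm ?invr_ge0// invf_le1// ler1n.
by rewrite mulrC ler_wpM2r// geo_sum_le2// normr_ge0.
Qed.

(** The difference has derivative x^N / (1 - x). Composing with t -> e t, where
    e is the sign of x, reduces to nonnegative arguments. *)
Lemma ln_lnpoly N x : `|x| <= 1 / 2 -> `|- ln (1 - x) - (lnpoly N).[x]| <=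
  2 * `|x| ^+ N.+1.
Proof.
move=> x1.
have [e [e1 ex]] : exists e : R, `|e| = 1 /\ x = e * `|x|.
  have [x0|x0] := leP 0 x; first by exists 1; rewrite normr1 mul1r ger0_norm.
  by exists (-1); rewrite normrN1 mulN1r ltr0_norm// opprK.
pose G := fun u => - ln (1 - u) - (lnpoly N).[u].
have Gd u : u < 1 -> is_derive u 1 G (u ^+ N / (1 - u)).
  move=> u1; have u10 : 0 < 1 - u by rewrite subr_gt0.
  have D1 : is_derive u 1 (fun u : R => 1 - u) (- 1).
    by apply: is_derive_eq; rewrite add0r mul1r.
  have D2 := @is_derive1_comp R (@ln R) (fun u : R => 1 - u) u _ _
    (is_derive1_ln u10) D1.
  have D3 := is_derive_poly (lnpoly N) u.
  have D4 := is_deriveB (is_deriveN D2) D3.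
  apply: (is_derive_eq D4).
  rewrite deriv_lnpoly mulrN1 opprK.
  apply: (mulfI (lt0r_neq0 u10)); rewrite mulrBr geo_sum mulfV ?gt_eqF//.
  by rewrite mulrCA mulfV ?gt_eqF// mulr1; ring.
have Gd' t : 0 <= t <= 1 / 2 ->
  is_derive t 1 (fun t => G (e * t)) ((e * t) ^+ N / (1 - e * t) * e).
  move=> /andP[t0 t1].
  have D1 : is_derive t 1 (fun t => e * t) e.
    by apply: is_derive_eq; rewrite /GRing.scale/= mulr1.
  apply: (@is_derive1_comp R G (fun t : R => e * t) t _ _ _ D1); apply: Gd.
  by apply: (le_lt_trans (ler_norm _)); rewrite normrM e1 mul1r ger0_norm//;
    lra.
have H : `|G (e * `|x|)| <= 2 * N`!%:R * (`|x| ^+ N.+1 / (N.+1)`!%:R).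
  apply: (@bound_of_derive _ (fun t => G (e * t))
    (fun t => (e * t) ^+ N / (1 - e * t) * e)
    (fun t => 2 * N`!%:R * (t ^+ N.+1 / (N.+1)`!%:R))
    (fun t => 2 * N`!%:R * (t ^+ N / N`!%:R)) (1 / 2)) => //.
  - by move=> t _; exact: is_derive_pow_fact.
  - move=> t /andP[t0 t1].
    have et : e * t <= 1 / 2.
      by apply: (le_trans (ler_norm _)); rewrite normrM e1 ger0_norm//; lra.
    rewrite !normrM e1 mulr1 normrX normrM e1 mul1r (ger0_norm t0).
    have -> : 2 * N`!%:R * (t ^+ N / N`!%:R) = t ^+ N * 2 :> R.
      by field; rewrite pnatr_eq0 -lt0n fact_gt0.
    rewrite ler_wpM2l ?exprn_ge0// ger0_norm ?invr_ge0; last by lra.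
    by rewrite -[leRHS]invrK lef_pV2 ?posrE//; lra.
  - by rewrite /G mulr0 subr0 ln1 oppr0 sub0r horner_lnpoly big1 ?oppr0// =>
    i _; rewrite expr0n mulr0.
  - by rewrite normr_ge0.
rewrite -ex in H; apply: (le_trans H).
rewrite (_ : 2 * _ * _ = 2 * `|x| ^+ N.+1 / N.+1%:R); last first.
  by rewrite factS natrM; field;
    rewrite -(natrD _ 1) !pnatr_eq0 /= -lt0n fact_gt0.
by rewrite ler_pdivrMr// ler_peMr ?mulr_ge0 ?exprn_ge0// ler1n.
Qed.

(** Polynomials with nonnegative coefficients serve as majorants: their
    coefficients are controlled by their value at a positive point. *)
Definition nneg_coefs P := forall i, 0 <= P`_i.

Lemma nneg_lnpoly N : nneg_coefs (lnpoly N).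
Proof.
move=> i; rewrite /lnpoly coef_sum sumr_ge0// => j _.
by rewrite coefZ coefXn mulr_ge0 ?invr_ge0.
Qed.

Lemma nneg_exp P k : nneg_coefs P -> nneg_coefs (P ^+ k).
Proof.
move=> P0; elim: k => [|k IH] i; first by rewrite expr0 coef1.
by rewrite exprS coefM sumr_ge0// => j _; rewrite mulr_ge0.
Qed.

Lemma coef_le_horner P rho l : nneg_coefs P -> 0 <= rho -> P`_l * rho ^+ l <=
  P.[rho].
Proof.
move=> P0 r0; have [lP|Pl] := ltnP l (size P); last first.
  rewrite nth_default// mul0r horner_coef sumr_ge0// => i _.
  by rewrite mulr_ge0 ?exprn_ge0.
rewrite horner_coef (bigD1 (Ordinal lP))//= lerDl sumr_ge0// => i _.
by rewrite mulr_ge0 ?exprn_ge0.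
Qed.

Lemma expB_bound k u v B : 0 <= B -> `|u| <= B -> `|v| <= B ->
  `|u ^+ k.+1 - v ^+ k.+1| <= `|u - v| * (k.+1%:R * B ^+ k).
Proof.
move=> B0 uB vB; rewrite subrXX normrM ler_wpM2l//.
apply: (le_trans (ler_norm_sum _ _ _)).
apply: (@le_trans _ _ (\sum_(i < k.+1) B ^+ k)).
  apply: ler_sum => i _; have ik : (i <= k)%N by rewrite -ltnS.
  rewrite normrM !normrX -[in leRHS](subnK ik) exprD.
  by rewrite ler_pM ?exprn_ge0// lerXn2r ?nnegrE.
by rewrite sumr_const card_ord mulr_natl.
Qed.

Lemma analytic_coefs (f : R -> R) x0 : analytic_at f x0 ->
  exists (a : nat -> R) (s A : R), [/\ 0 < s, 0 < A, a 0%N = f x0,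
    (forall k, `|a k| * s ^+ k <= A) &
    forall h, `|h| <= s -> pseries a h @ \oo --> f (x0 + h)].
Proof.
move=> [a /nbhs_ballP[d /= d0 H]]; exists a, (d / 2).
have s0 : 0 < d / 2 by rewrite divr_gt0.
have P h : `|h| <= d / 2 -> pseries a h @ \oo --> f (x0 + h).
  move=> hs; have := H (x0 + h); rewrite /= addrAC subrr add0r; apply.
  rewrite /ball/= opprD addrA subrr sub0r normrN; apply: (le_lt_trans hs).
  by rewrite ltr_pdivrMr// ltr_pMr// ltr1n.
have a0 : a 0%N = f x0.
  have /P : `|0 : R| <= d / 2 by rewrite normr0 ltW.
  rewrite addr0 => C; apply: (cvg_unique _ _ C); first exact: norm_hausdorff.
  apply: (@cvg_near_cst _ _ _ _ _ _); exists 1%N => // n /= n1.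
  rewrite /pseries /series/= big_ltn// expr0 mulr1 big_nat big1 ?addr0// =>
    i /andP[i1 _].
  by rewrite expr0n gtn_eqF// mulr0.
have Cs : cvgn (pseries a (d / 2)).
  by apply/cvg_ex; exists (f (x0 + d / 2)); apply: P; rewrite ger0_norm// ltW.
have /cvg_seq_bounded[M [Mr HM]] : cvgn (fun k => a k * (d / 2) ^+ k).
  by apply/cvg_ex; exists 0; exact: (cvg_series_cvg_0 Cs).
exists (Num.max M 0 + 1); split => //.
  by rewrite ltr_wpDl// le_max lexx orbT.
move=> k; rewrite -[in X in X <= _](gtr0_norm s0) -normrX -normrM;
  apply: HM => //.
by rewrite (@le_lt_trans _ _ (Num.max M 0)) ?le_max ?lexx// ltrDl.
Qed.

(** Composition of the power series of f at x0 with that of - c ln (1 - x),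
    done on truncations: the degree-L polynomials are cut out of the sum of a_k
    c^k Lambda^k, Lambda being a partial sum of the logarithm series. As Lambda
    has nonnegative coefficients, the coefficients of the composite at rho are
    dominated by sum |a_k| (2 c rho)^k, which is bounded uniformly in L for
    small rho. At |x| <= rho / 2 the cut costs a geometric tail in 1/2. *)
Lemma analytic_approx (f : R -> R) x0 c : 0 < c -> analytic_at f x0 ->
  exists rho K : R, [/\ 0 < rho <= 1 / 2, 0 < K & forall L, exists T : {poly R},
    [/\ (size T <= L.+1)%N, T`_0 = f x0, forall l, `|T`_l| * rho ^+ l <= K &
     forall x, `|x| <= rho / 2 ->
       `|f (x0 - c * ln (1 - x)) - T.[x]| <= K * L.+1%:R ^+ 2 / 2 ^+ L.+1]].
Proof.
move=> c0 /analytic_coefs[a [s [A [s0 A0 a0 aA fa]]]].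
(* partial sums of the logarithm are at most 2 rho at rho, so c times them
   stays below s / 2 *)
pose rho := Num.min (1 / 2) (s / (4 * c)).
have rho_gt0 : 0 < rho by rewrite lt_min !divr_gt0// mulr_gt0.
have rho_le : rho <= 1 / 2 by rewrite ge_min lexx.
have rhos : 4 * c * rho <= s.
  by rewrite mulrC -ler_pdivlMr ?mulr_gt0// ge_min lexx orbT.
have term k y : 0 <= y -> 2 * c * y <= s -> `|a k| * c ^+ k * y ^+ k <=
  A * 2^-1 ^+ k.
  move=> y0 ys; rewrite -mulrA -exprMn.
  apply: (@le_trans _ _ (`|a k| * (s / 2) ^+ k)).
    rewrite ler_wpM2l// lerXn2r ?nnegrE//; [|lra|lra].
    by rewrite mulr_ge0 ?(ltW c0).
  by rewrite exprMn mulrA ler_wpM2r// exprn_ge0.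
exists rho, (7 * A); split; [by rewrite rho_gt0|by rewrite mulr_gt0|].
move=> L.
pose P : {poly R} := \sum_(k < L.+1) (a k * c ^+ k) *: lnpoly L.+1 ^+ k.
have Pc l : `|P`_l| * rho ^+ l <= 2 * A.
  rewrite /P coef_sum; apply: (@le_trans _ _ (\sum_(k < L.+1) A * 2^-1 ^+ k));
    last first.
    by rewrite -mulr_sumr mulrC ler_wpM2r ?(ltW A0)// geo_sum_le2//; lra.
  apply: (@le_trans _ _ (\sum_(k < L.+1) `|a k| * c ^+ k * (2 * rho) ^+ k));
    last first.
    by apply: ler_sum => k _; apply: term; lra.
  apply: (le_trans (ler_wpM2r (exprn_ge0 _ (ltW rho_gt0))
    (ler_norm_sum _ _ _))).
  rewrite mulr_suml; apply: ler_sum => k _.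
  rewrite coefZ !normrM normrX (gtr0_norm c0) -[leLHS]mulrA ler_wpM2l ?mulr_ge0
    ?exprn_ge0 ?(ltW c0)//.
  have n0 := nneg_exp _ k (nneg_lnpoly L.+1).
  rewrite ger0_norm//; apply:
    (le_trans (coef_le_horner _ _ _ n0 (ltW rho_gt0))).
  rewrite horner_exp lerXn2r ?nnegrE//; last 1 first.
  - apply: (le_trans (ler_norm _)); have := norm_lnpoly L.+1 rho.
    by rewrite (gtr0_norm rho_gt0); apply.
  - by rewrite horner_lnpoly sumr_ge0// => i _;
    rewrite mulr_ge0 ?exprn_ge0 ?invr_ge0 ?(ltW rho_gt0).
  - by rewrite mulr_ge0// ltW.
exists (take_poly L.+1 P); split.
- exact: size_take_poly.
- rewrite coef_take_poly/= /P coef_sum big_ord_recl/= expr0 mulr1 expr0 coefZ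
  coef1 mulr1.
  rewrite big1 ?addr0// => k _;
    rewrite coefZ -horner_coef0 horner_exp horner_lnpoly.
  by rewrite big1 ?expr0n ?mulr0// => i _; rewrite expr0n mulr0.
- move=> l; rewrite coef_take_poly; case: ifP => _;
  last by rewrite normr0 mul0r mulr_ge0 ?ltW.
  by apply: (le_trans (Pc l)); rewrite ler_wpM2r ?(ltW A0)//; lra.
move=> x xr.
have x12 : `|x| <= 1 / 2 by lra.
set u := - ln (1 - x); have -> :
  x0 - c * ln (1 - x) = x0 + c * u by rewrite mulrN.
have u_le : `|u| <= rho.
  have := ln_lnpoly 0 x x12; rewrite horner_lnpoly big_ord0 subr0 expr1 -/u;
    lra.
set v := (lnpoly L.+1).[x].
have v_le : `|v| <= rho by have := norm_lnpoly L.+1 x x12; rewrite -/v; lra.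
have E1 : `|f (x0 + c * u) - \sum_(k < L.+1) a k * (c * u) ^+ k| <=
  2 * A / 2 ^+ L.+1.
  have /fa C : `|c * u| <= s.
    rewrite normrM (gtr0_norm c0); apply: (@le_trans _ _ (c * rho)).
      by rewrite ler_wpM2l// ltW.
    have : 0 < c * rho by rewrite mulr_gt0.
    lra.
  set S := \sum_(k < L.+1) _.
  have C2 : pseries a (c * u) n - S @[n --> \oo] --> f (x0 + c * u) - S.
    by apply: cvgB => //; exact: cvg_cst.
  apply: (cvgr_to_le (cvg_norm C2)); exists L.+1 => // n /= Ln.
  rewrite /pseries /series/= (big_cat_nat _ Ln)//= big_mkord addrAC subrr add0r.
  rewrite -[L.+1 in X in `|X|]add0n big_addn big_mkord.
  apply: (le_trans (ler_norm_sum _ _ _)).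
  apply: (@le_trans _ _ (\sum_(i < n - L.+1) A * 2^-1 ^+ L.+1 * 2^-1 ^+ i));
    last first.
    by rewrite -mulr_sumr exprVn mulrC mulrA ler_wpM2r ?invr_ge0
      ?exprn_ge0// ler_wpM2r ?(ltW A0)// geo_sum_le2//; lra.
  apply: ler_sum => i _.
  rewrite normrM normrX normrM (gtr0_norm c0) exprMn mulrA.
  apply: (le_trans (term _ _ (normr_ge0 u) _));
    last by rewrite addnC exprD mulrA.
  apply: le_trans rhos; apply: (@le_trans _ _ (2 * c * rho)).
    by rewrite ler_wpM2l// mulr_ge0// ltW.
  by rewrite ler_wpM2r ?(ltW rho_gt0)// ler_wpM2r ?(ltW c0)//; lra.
have E2 : `|\sum_(k < L.+1) a k * (c * u) ^+ k - P.[x]| <=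
  A * L.+1%:R ^+ 2 / 2 ^+ L.+1.
  rewrite /P horner_sum -sumrB; apply: (le_trans (ler_norm_sum _ _ _)).
  rewrite (_ : A * _ / _ = \sum_(k < L.+1) A * L.+1%:R / 2 ^+ L.+1); last first.
    by rewrite sumr_const card_ord -mulr_natr; ring.
  apply: ler_sum => k _.
  rewrite hornerZ horner_exp -/v exprMn mulrA -mulrBr !normrM normrX
    (gtr0_norm c0).
  case: k => -[|k] kL /=.
    by rewrite !expr0 subrr normr0 mulr0 divr_ge0 ?mulr_ge0 ?exprn_ge0
      ?(ltW A0).
  have uv : `|u - v| <= rho * 2^-1 ^+ L.+1.
    apply: (le_trans (ln_lnpoly _ _ x12)).
    apply: (@le_trans _ _ (2 * (rho / 2) ^+ L.+2)).
      by rewrite ler_wpM2l// lerXn2r ?nnegrE//; lra.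
    rewrite exprMn !exprS; set q := 2^-1 ^+ L.
    have r1 : rho * rho ^+ L.+1 <= rho.
      by rewrite ler_piMr ?(ltW rho_gt0)// exprn_ile1 ?(ltW rho_gt0)//; lra.
    have q0 : 0 <= 2^-1 * q by rewrite mulr_ge0 ?exprn_ge0.
    have := ler_wpM2r q0 r1; rewrite !exprS; lra.
  apply: (@le_trans _ _ (`|a
    k.+1| * c ^+ k.+1 * (rho * 2^-1 ^+ L.+1 * (k.+1%:R * rho ^+ k)))).
    rewrite ler_wpM2l ?mulr_ge0 ?exprn_ge0 ?(ltW c0)//.
    apply: (le_trans (expB_bound _ _ _ _ (ltW rho_gt0) u_le v_le)).
    by rewrite ler_wpM2r// mulr_ge0 ?exprn_ge0 ?(ltW rho_gt0).
  rewrite (_ : _ * _ * _ = (`|a k.+1| * c ^+ k.+1 * rho ^+ k.+1) * k.+1%:R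
    * 2^-1 ^+ L.+1); last first.
    by rewrite [rho ^+ k.+1]exprS; ring.
  rewrite exprVn ler_wpM2r ?invr_ge0 ?exprn_ge0// ler_pM ?mulr_ge0 ?exprn_ge0
    ?(ltW c0) ?(ltW rho_gt0)//.
    apply: (le_trans (term _ _ (ltW rho_gt0) _));
      last by rewrite ler_piMr ?(ltW A0)// exprn_ile1//; lra.
    by apply: le_trans rhos; rewrite ler_wpM2r ?(ltW rho_gt0)// ler_wpM2r
      ?(ltW c0)//; lra.
  by rewrite ler_nat ltnW.
have E3 : `|P.[x] - (take_poly L.+1 P).[x]| <= 4 * A / 2 ^+ L.+1.
  rewrite -{1}(poly_take_drop L.+1 P) hornerD addrAC subrr add0r hornerM
    hornerXn horner_coef.
  rewrite normrM; apply: (le_trans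
    (ler_wpM2r (normr_ge0 _) (ler_norm_sum _ _ _))).
  rewrite mulr_suml.
  apply: (@le_trans _ _ (\sum_(i < size (drop_poly L.+1 P))
    2 * A * 2^-1 ^+ L.+1 * 2^-1 ^+ i)); last first.
    rewrite -mulr_sumr exprVn; apply: (@le_trans _ _ (2 * A / 2 ^+ L.+1 * 2)).
      by rewrite ler_wpM2l ?mulr_ge0 ?invr_ge0 ?exprn_ge0
        ?(ltW A0)// geo_sum_le2//; lra.
    by rewrite (_ : _ * 2 = 4 * A / 2 ^+ L.+1)//; ring.
  apply: ler_sum => i _; rewrite coef_drop_poly normrM !normrX -mulrA -exprD.
  rewrite -[leRHS]mulrA -exprD [(L.+1 + i)%N]addnC.
  apply: (@le_trans _ _ (`|P`_(i + L.+1)| * (rho / 2) ^+ (i + L.+1))).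
    by rewrite ler_wpM2l// lerXn2r ?nnegrE//; lra.
  by rewrite exprMn mulrA ler_wpM2r ?exprn_ge0.
have N2 : 1 <= L.+1%:R ^+ 2 :> R by rewrite expr2 -natrM ler1n.
rewrite (_ : _ - _ = (f (x0 + c * u) - \sum_(k < L.+1) a k * (c * u) ^+ k) +
  (\sum_(k < L.+1) a k * (c * u) ^+ k - P.[x]) +
    (P.[x] - (take_poly L.+1 P).[x])); last by ring.
apply: (le_trans (ler_normD _ _));
  apply: (le_trans (lerD (ler_normD _ _) (lexx _))).
have i0 : (0 : R) <= (2 ^+ L.+1)^-1 by rewrite invr_ge0 exprn_ge0.
have : A / 2 ^+ L.+1 <= A * L.+1%:R ^+ 2 / 2 ^+ L.+1.
  by rewrite ler_wpM2r// ler_peMr// ltW.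
move: i0 E1 E2 E3 N2; set q := (2 ^+ L.+1)^-1; set n2 := L.+1%:R ^+ 2.
set y1 := `|_|; set y2 := `|_|; set y3 := `|_| => i0 E1 E2 E3 N2 H.
have Aq : 0 <= A * q by rewrite mulr_ge0// ltW.
have -> : 7 * A * n2 * q = 7 * (A * n2 * q) by ring.
move: H E1 E2 E3; rewrite -[2 * A * q]mulrA -[4 * A * q]mulrA.
set z := A * n2 * q; set z' := A * q => *; lra.
Qed.
End Approx.

(** * Integral representation *)

Section Integral.
Context {R : realType}.
Notation mu := (@lebesgue_measure R).
Notation D := (`]0%R, +oo[%classic : set (measurableTypeR R)).
Let mD : measurable D := @measurable_itv R _.
Implicit Types (z lam w : R) (f g : R -> R) (T P : {poly R}).

(** In the extended reals a difference is finite only when both terms are, here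
    the integrals of the positive and negative parts. *)
Lemma integrable_of_fin_num g : measurable_fun D (g : measurableTypeR R -> R) ->
  (\int[mu]_(x in D) (g x)%:E)%E \is a fin_num -> mu.-integrable D (EFin \o g).
Proof.
move=> mg.
have mEg : measurable_fun D (EFin \o g) by exact/measurable_EFinP.
rewrite integralE fin_numB => /andP[fp fn].
rewrite (funeposneg (EFin \o g)); apply: integrableB => //; apply/integrableP;
  split.
- exact: measurable_funepos.
- by under eq_integral do rewrite gee0_abs//; rewrite ltey_eq fp.
- exact: measurable_funeneg.
- by under eq_integral do rewrite gee0_abs//; rewrite ltey_eq fn.
Qed.

(** The density of the exponential law of rate z, divided by z. *)
Lemma exp_integral z : 0 < z ->
  mu.-integrable D (EFin \o (fun x => expR (- (z * x)))) /\
  \int[mu]_(x in D) expR (- (z * x)) = z^-1.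
Proof.
move=> z0.
have mD0 : measurable (`[0%R, +oo[%classic : set (measurableTypeR R))
  by exact: measurable_itv.
have I1 : mu.-integrable `[0%R, +oo[ (EFin \o (fun x => expR (- (z * x)))).
  have H : mu.-integrable `[0%R, +oo[ (EFin \o (fun x => z * expR (- z * x))).
    apply/(integrable_mkcond _ mD0).
    rewrite restrict_EFin; exact: (integrable_exponential_pdf z0).
  have := integrableZl mD0 (z^-1) H; apply: eq_integrable => //= x _.
  by rewrite -EFinM mulKf ?gt_eqF// mulNr.
have I2 : mu.-integrable D (EFin \o (fun x => expR (- (z * x)))).
  apply: integrableS I1 => //; apply: subset_itvr; by rewrite bnd_simp.
split => //; rewrite Rintegral_itv_obnd_cbnd//.
have E : (\int[mu]_(x in `[0%R, +oo[) (z * expR (- z * x))%:E = 1)%E.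
  rewrite integral_mkcond -(integral_exponential_pdf z0); apply: eq_integral =>
    x _.
  by rewrite restrict_EFin.
apply: (mulfI (lt0r_neq0 z0)); rewrite mulfV ?gt_eqF// -RintegralZl//.
rewrite /Rintegral -[RHS]/(fine 1%E) -E; congr fine.
by apply: eq_integral => x _; rewrite mulNr.
Qed.

Lemma Rintegral_sum N (c : nat -> R) (F : nat -> R -> R) :
  (forall i, (i < N)%N -> mu.-integrable D (EFin \o F i)) ->
  mu.-integrable D (EFin \o (fun x => \sum_(i < N) c i * F i x)) /\
  \int[mu]_(x in D) (\sum_(i < N) c i * F i x) = \sum_(i < N) c
    i * \int[mu]_(x in D) F i x.
Proof.
elim: N => [|N IH] IF.
  split; last by under eq_Rintegral do rewrite big_ord0;
    rewrite Rintegral_cst// mul0r big_ord0.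
  rewrite (_ : EFin \o _ = cst 0%E); first exact: integrable0.
  by apply/funext => x /=; rewrite big_ord0.
have [IH1 IH2] := IH (fun i iN => IF i (ltnW iN)).
have IN : mu.-integrable D (EFin \o (fun x => c N * F N x)).
  by have := integrableZl mD (c N) (IF N (leqnn _));
    apply: eq_integrable => //= x _; rewrite EFinM.
split.
  have := integrableD mD IH1 IN; apply: eq_integrable => //= x _.
  by rewrite big_ord_recr.
under eq_Rintegral do rewrite big_ord_recr/=.
by rewrite RintegralD// IH2 RintegralZl ?big_ord_recr//; exact: IF.
Qed.

Section Transform.
Context (f : R -> R) (x0 : R)
  (f_loc : locally_integrable `]0%R, +oo[ f)
  (f_laplace : forall z : R, 0 < z -> laplace f z \is a fin_num)
  (x0_gt0 : 0 < x0).

Let lam := ln 2 / x0.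
Let lam_gt0 : 0 < lam. Proof. by rewrite divr_gt0 ?ln_gt0 ?ltr1n. Qed.
Let w y := expR (- (lam * y)).

Lemma integrable_expMf z : 0 < z ->
  mu.-integrable D (EFin \o (fun y => expR (- (z * y)) * f y)).
Proof.
move=> z0; apply: integrable_of_fin_num; last exact: f_laplace.
apply: measurable_funM.
  apply: measurable_funTS; apply: continuous_measurable_fun.
  move=> y; apply: continuous_comp; last exact: continuous_expR.
  by apply: continuousN; apply: continuousM;
    [exact: cst_continuous|exact: cvg_id].
by case: f_loc.
Qed.

Lemma expX_w k y : expR (- (k%:R * lam * y)) = w y ^+ k.
Proof. by rewrite /w -expRM_natl; congr expR; ring. Qed.

(** The substitution w = exp (- lam y), carried out monomial by monomial. *)
Lemma integral_poly P : mu.-integrable D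
  (EFin \o (fun y => lam * (w y * P.[w y]))) /\
  \int[mu]_(y in D) (lam * (w y * P.[w y])) = int01 P.
Proof.
have [I1 I2] := @Rintegral_sum (size P) (fun i => lam * P`_i)
  (fun i y => expR (- (i.+1%:R * lam * y)))
  (fun i _ => (exp_integral _ (mulr_gt0 (ltr0Sn _ i) lam_gt0)).1).
have E y : \sum_(i < size P) lam * P`_i * expR (- (i.+1%:R * lam * y)) =
  lam * (w y * P.[w y]).
  rewrite horner_coef !mulr_sumr; apply: eq_bigr => i _.
  by rewrite expX_w exprS; ring.
split; first by apply: eq_integrable I1 => // y _ /=; rewrite E.
under eq_Rintegral do rewrite -E.
rewrite I2 /int01; apply: eq_bigr => i _.
rewrite (exp_integral _ (mulr_gt0 (ltr0Sn _ i) lam_gt0)).2.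
by field; rewrite (gt_eqF lam_gt0) -(natrD _ 1) pnatr_eq0.
Qed.

Lemma gaver_stehfest_integral n :
  mu.-integrable D (EFin \o (fun y =>
    lam * (f y * stehfest_kernel n (w y * (1 - w y))))) /\
  gaver_stehfest f n x0 = \int[mu]_(y in D)
    (lam * (f y * stehfest_kernel n (w y * (1 - w y)))).
Proof.
have [I1 I2] := @Rintegral_sum (2 * n) (fun i => lam * stehfest_coef R n i.+1)
  (fun i y => expR (- (i.+1%:R * lam * y)) * f y)
  (fun i _ => integrable_expMf _ (mulr_gt0 (ltr0Sn _ i) lam_gt0)).
have E y : \sum_(i < 2 * n) lam * stehfest_coef R n
  i.+1 * (expR (- (i.+1%:R * lam * y)) * f y) =
    lam * (f y * stehfest_kernel n (w y * (1 - w y))).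
  rewrite -sum_stehfest big_add1 /= big_mkord !mulr_sumr; apply: eq_bigr => i _.
  by rewrite expX_w; ring.
split; first by apply: eq_integrable I1 => // y _ /=; rewrite E.
under eq_Rintegral do rewrite -E.
rewrite I2 /gaver_stehfest big_add1 /= big_mkord mulr_sumr; apply: eq_bigr =>
  i _.
by rewrite mulrA /laplace /Rintegral -/lam -[_ * _ * x0^-1]mulrA.
Qed.

(** Both terms on the left are integrals against the same kernel, so a
    pointwise bound of the integrand suffices. The constant F0 is the integral
    of lam exp (- lam y) |f(y)|. *)
Lemma gaver_stehfest_sub_poly : exists2 F0 : R, 0 <= F0 &
  forall n (T : {poly R}) (B1 B2 : R), (0 < n)%N ->
  (forall y, 0 < y -> `|(f y - T.[1 - 2 * w y]) * stehfest_kernel n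
    (w y * (1 - w y))| <= (B1 + B2 * `|f y|) * w y) ->
  `|gaver_stehfest f n x0 - int01 ((T \Po (xpoly (R:=R))) * stehfest_poly n)| <=
    B1 + B2 * F0.
Proof.
pose g y := lam * (w y * `|f y|).
have Ig : mu.-integrable D (EFin \o g).
  have := integrableZl mD lam (integrable_abse (integrable_expMf _ lam_gt0)).
  apply: eq_integrable => // y _ /=.
  by rewrite -EFinM normrM ger0_norm ?expR_ge0.
exists (\int[mu]_(y in D) g y).
  by apply: Rintegral_ge0 => y _; apply: mulr_ge0;
    [exact: ltW | apply: mulr_ge0; [exact: expR_ge0|exact: normr_ge0]].
move=> n T B1 B2 n0 H.
have [I1 ->] := gaver_stehfest_integral n.
have [I2 <-] := integral_poly ((T \Po (xpoly (R:=R))) * stehfest_poly n).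
rewrite -RintegralB//.
set h := (fun y => _ - _).
have Ih : mu.-integrable D (EFin \o h).
  by have := integrableB mD I1 I2; apply: eq_integrable.
have [I3 E3] := integral_poly B1%:P.
have I4 : mu.-integrable D (EFin \o (fun y => B2 * g y)).
  by have := integrableZl mD B2 Ig; apply: eq_integrable => // y _ /=;
    rewrite EFinM.
have I34 : mu.-integrable D
  (EFin \o (fun y => lam * (w y * (B1%:P).[w y]) + B2 * g y)).
  by have := integrableD mD I3 I4; apply: eq_integrable.
apply: (le_trans (le_normr_Rintegral mD Ih)).
apply: (@le_trans _ _ (\int[mu]_(y in D)
  (lam * (w y * (B1%:P).[w y]) + B2 * g y))).
  apply: le_Rintegral => //.
    by have := integrable_abse Ih; apply: eq_integrable.
  move=> y /=; rewrite in_itv/= andbT => y0.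
  rewrite /h hornerC hornerM horner_comp.
  rewrite (_ : w y * (_ * (stehfest_poly n).[_]) =
    T.[1 - 2 * w y] * stehfest_kernel n (w y * (1 - w y))); last first.
    rewrite mulrCA horner_stehfest_poly//; congr (T.[_] * _).
    by rewrite /xpoly hornerD hornerN hornerZ hornerX hornerC.
  rewrite -mulrBr -mulrBl normrM (gtr0_norm lam_gt0).
  apply: (le_trans (ler_wpM2l (ltW lam_gt0) (H y y0))).
  by rewrite /g le_eqVlt; apply/orP; left; apply/eqP; ring.
rewrite RintegralD// E3 RintegralZl// lerD2r.
by rewrite /int01 size_polyC; case: eqP => [->|_];
  rewrite ?big_ord0// big_ord1 coefC divr1.
Qed.
End Transform.
End Integral.

(** * Exponential convergence *)

Section Convergence.
Context {R : realType}.
Implicit Types (f : R -> R) (T P : {poly R}).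

(** The three terms are: the approximation error of f near x = 0 times the
    polynomial size of the kernel; the contribution of |x| > rho / 2, where the
    kernel is small but f and the polynomial are not close; and the moments of
    positive order. *)
Lemma gaver_stehfest_error_terms f x0 :
  locally_integrable `]0%R, +oo[ f ->
  (forall z : R, 0 < z -> laplace f z \is a fin_num) -> 0 < x0 ->
    analytic_at f x0 ->
  exists th rho A : R, [/\ 0 < th < 1, 0 < rho < 1, 0 < A &
   forall n L, `|gaver_stehfest f n.+1 x0 - f x0| <=
     A * (L.+1%:R ^+ 2 * n.+1%:R ^+ 2 / 2 ^+ L.+1 +
          L.+1%:R * n.+1%:R * th ^+ n / rho ^+ L.+1 +
          L.+1%:R / rho ^+ L.+1 * ((4 * L.+1%:R) ^+ n.+1 / (n.+1)`!%:R))].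
Proof.
move=> f_loc f_laplace x0_gt0 f_an.
have ln2 : 0 < ln 2 :> R by rewrite ln_gt0// ltr1n.
pose c := x0 / ln 2; have c0 : 0 < c by rewrite divr_gt0.
have [rho [K [/andP[rho0 rho1] K0 approx]]] := analytic_approx f x0 c c0 f_an.
have rho_sq : 0 < rho ^+ 2 / 4 <= 1.
  rewrite divr_gt0 ?exprn_gt0//= ler_pdivrMr// mul1r.
  have : rho ^+ 2 <= 1 by rewrite exprn_ile1 ?(ltW rho0)//; lra.
  lra.
have [th [C [th01 C0 decay]]] := stehfest_kernel_decay _ rho_sq.
have [C2 C20 poly_bd] := @stehfest_kernel_poly_bound R.
have [F0 F00 error] := gaver_stehfest_sub_poly f x0 f_loc f_laplace x0_gt0.
have /andP[th0 th1] := th01.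
exists th, rho, (K * C2 + C * (K + F0) + K); split => //.
- by rewrite rho0/=; lra.
- by rewrite addr_gt0 ?addr_gt0 ?mulr_gt0// ltr_pwDl.
move=> n L; have [T [sT T0 Tc Tx]] := approx L.
pose l : R := L.+1%:R; pose m : R := n.+1%:R.
have l1 : 1 <= l by rewrite ler1n.
have m1 : 1 <= m by rewrite ler1n.
pose ri := (rho ^+ L.+1)^-1.
have ri1 : 1 <= ri by rewrite invf_ge1 ?exprn_gt0// exprn_ile1 ?(ltW rho0)//;
  lra.
have Tci k : (k <= L.+1)%N -> `|T`_k| <= K * ri.
  move=> kL; apply: (@le_trans _ _ (K / rho ^+ k)).
    by rewrite ler_pdivlMr ?exprn_gt0// Tc.
  rewrite ler_wpM2l ?(ltW K0)// lef_pV2 ?posrE ?exprn_gt0//.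
  by rewrite ler_wiXn2l// ?(ltW rho0)//; lra.
have main : `|gaver_stehfest f n.+1 x0 -
  int01 ((T \Po xpoly) * stehfest_poly n.+1)| <=
    (K * C2 * (l ^+ 2 * m ^+ 2 / 2 ^+ L.+1) + C * K * (l * m * th ^+ n * ri)) +
      C * m * th ^+ n * F0.
  apply: error => // y y0.
  have lam0 : 0 < ln 2 / x0 by rewrite divr_gt0.
  set w := expR _; pose x := 1 - 2 * w; pose v := w * (1 - w).
  have w0 : 0 < w by exact: expR_gt0.
  have w1 : w < 1 by rewrite -expR0 ltr_expR oppr_lt0 mulr_gt0.
  have v0 : 0 <= v by rewrite mulr_ge0 ?ltW// subr_gt0.
  have vw : v <= w by rewrite ler_piMr ?(ltW w0)//; lra.
  have xv : 4 * v = 1 - x ^+ 2 by rewrite /v /x; ring.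
  have x1 : `|x| <= 1 by rewrite ler_norml /x; lra.
  have -> : 1 - 2 * w = x by [].
  have -> : w * (1 - w) = v by [].
  have th_n : 0 <= th ^+ n by rewrite exprn_ge0 ?ltW.
  have t1 : 0 <= K * C2 * (l ^+ 2 * m ^+ 2 / 2 ^+ L.+1).
    by rewrite !mulr_ge0 ?invr_ge0 ?exprn_ge0 ?(ltW K0) ?(ltW C20).
  have t2 : 0 <= C * K * (l * m * th ^+ n * ri).
    by rewrite !mulr_ge0 ?(ltW K0) ?(ltW C0)//; lra.
  have t3 : 0 <= C * m * th ^+ n * `|f y| by rewrite !mulr_ge0 ?(ltW C0).
  rewrite normrM; have [xr|xr] := leP `|x| (rho / 2).
    have yE : f y = f (x0 - c * ln (1 - x)).
      congr f; rewrite (_ : 1 - x = 2 * w); last by rewrite /x; ring.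
      rewrite lnM ?posrE// /w expRK /c; field.
      by rewrite !gt_eqF.
    apply: (@le_trans _ _ (K * C2 * (l ^+ 2 * m ^+ 2 / 2 ^+ L.+1) * w)).
      rewrite (_ : _ * w = (K * l ^+ 2 / 2 ^+ L.+1) * (C2 * m ^+ 2 * w));
        last by ring.
      apply: ler_pM => //; first by rewrite yE Tx.
      apply: (le_trans (poly_bd n v v0 _)).
        by rewrite xv gerBl sqr_ge0.
      by rewrite ler_wpM2l// mulr_ge0 ?exprn_ge0 ?(ltW C20).
    by rewrite ler_wpM2r ?(ltW w0)//; lra.
  apply: (@le_trans _ _ ((C * K * (l * m * th ^+ n * ri) +
    C * m * th ^+ n * `|f y|) * w)); last first.
    by rewrite ler_wpM2r ?(ltW w0)//; lra.
  rewrite (_ : (_ + _) * w = (K * l * ri + `|f y|) * (C * m * th ^+ n * w));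
    last by ring.
  apply: ler_pM => //.
    apply: (le_trans (ler_normB _ _)); rewrite addrC lerD2r.
    rewrite (horner_coef_wide _ sT); apply: (le_trans (ler_norm_sum _ _ _)).
    rewrite (_ : K * l * ri = \sum_(i < L.+1) K * ri); last first.
      by rewrite sumr_const card_ord -mulr_natr; ring.
    apply: ler_sum => i _; rewrite normrM normrX -[leRHS]mulr1.
    rewrite ler_pM ?exprn_ge0 ?exprn_ile1// Tci//.
    by apply: ltnW; exact: ltn_ord.
  apply: (le_trans (decay n v v0 _)).
    rewrite xv lerD2l lerN2 -(real_normK (num_real x)).
    rewrite (_ : rho ^+ 2 / 4 = (rho / 2) ^+ 2); last by field.
    by rewrite lerXn2r ?nnegrE// ?(ltW xr)// divr_ge0// ltW.
  by rewrite ler_wpM2l// !mulr_ge0 ?(ltW C0).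
have mom : `|int01 ((T \Po xpoly) * stehfest_poly n.+1) - f x0| <=
    K * (l * ri * ((4 * l) ^+ n.+1 / (n.+1)`!%:R)).
  have -> : int01 ((T \Po xpoly) * stehfest_poly n.+1) = \sum_(i < L.+1)
    T`_i * int01 (xpoly ^+ i * stehfest_poly n.+1).
    rewrite comp_polyE mulr_suml int01_sum.
    rewrite -(big_mkord xpredT
      (fun i => int01 (T`_i *: xpoly ^+ i * stehfest_poly n.+1))).
    rewrite -(big_mkord xpredT
      (fun i => T`_i * int01 (xpoly ^+ i * stehfest_poly n.+1))).
    rewrite [RHS](big_cat_nat _ sT)//= [X in _ = _ + X]big_nat_cond
      [X in _ = _ + X]big1 ?addr0.
      by apply: eq_bigr => i _; rewrite -scalerAl int01Z.
    by move=> i /andP[/andP[Pi _] _]; rewrite nth_default// mul0r.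
  rewrite big_ord_recl/= expr0 mul1r stehfest_moment0// mulr1 T0 addrAC subrr
    add0r.
  apply: (le_trans (ler_norm_sum _ _ _)).
  set B := (4 * l) ^+ n.+1 / (n.+1)`!%:R.
  have B0 : 0 <= B by rewrite divr_ge0// exprn_ge0// mulr_ge0//; lra.
  apply: (@le_trans _ _ (\sum_(i < L) K * ri * B)).
    apply: ler_sum => i _; rewrite normrM; apply: ler_pM => //.
      by rewrite Tci// /bump/= add1n ltnS ltnW.
    have iL : (0 < i.+1 <= L.+1)%N by rewrite ltn0Sn; exact: leqW (ltn_ord i).
    have MB := @stehfest_moment_bound R n.+1 i.+1 L.+1 (ltn0Sn n) iL.
    exact: MB.
  rewrite sumr_const card_ord -mulr_natr.
  rewrite (_ : K * (l * ri * B) = K * ri * B * l); last by ring.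
  apply: ler_wpM2l; last by rewrite /l ler_nat.
  by rewrite mulr_ge0// mulr_ge0 ?(ltW K0)// (le_trans ler01).
rewrite -[_ - f x0](subrKA (int01 ((T \Po xpoly) * stehfest_poly n.+1))).
apply: (le_trans (ler_normD _ _)); apply: (le_trans (lerD main mom)).
rewrite -/l -/m -/ri.
have th_n : 0 <= th ^+ n by rewrite exprn_ge0 ?ltW.
set s1 := l ^+ 2 * m ^+ 2 / 2 ^+ L.+1; set s2 := l * m * th ^+ n * ri.
set s3 := l * ri * _.
have s10 : 0 <= s1 by rewrite divr_ge0 ?mulr_ge0 ?exprn_ge0.
have s20 : 0 <= s2 by rewrite !mulr_ge0//; lra.
have s30 : 0 <= s3 by rewrite mulr_ge0 ?divr_ge0 ?exprn_ge0 ?mulr_ge0//; lra.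
have H1 : K * C2 * s1 <= K * C2 * (s1 + s2 + s3).
  by rewrite ler_wpM2l ?mulr_ge0 ?(ltW K0) ?(ltW C20)//; lra.
have H2 : C * (K + F0) * s2 <= C * (K + F0) * (s1 + s2 + s3).
  by rewrite ler_wpM2l ?mulr_ge0 ?addr_ge0 ?(ltW K0) ?(ltW C0)//; lra.
have H3 : K * s3 <= K * (s1 + s2 + s3).
  by rewrite ler_wpM2l ?(ltW K0)//; lra.
have H4 : C * m * th ^+ n * F0 <= C * F0 * s2.
  rewrite (_ : C * m * th ^+ n * F0 = C * F0 * (m * th ^+ n)); last by ring.
  rewrite ler_wpM2l ?mulr_ge0 ?(ltW C0)//.
  rewrite (_ : s2 = m * th ^+ n * (l * ri)); last by rewrite /s2; ring.
  by rewrite ler_peMr ?mulr_ge0// mulr_ege1.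
lra.
Qed.

(** With m = n + 1, take L + 1 = m / d up to rounding: d large makes rho^-(L+1)
    at most th^(-m/2) and at most exp m, and makes the factor (8 / d)^m exp m
    that bounds (4 (L + 1))^m / m! at most exp (- 2 m). *)
Lemma error_terms_decay (th rho : R) : 0 < th < 1 -> 0 < rho < 1 ->
  exists (c M : R) (d : nat), [/\ 0 < c, 0 < M & forall n, (d <= n)%N ->
   exists L : nat,
     L.+1%:R ^+ 2 * n.+1%:R ^+ 2 / 2 ^+ L.+1 +
          L.+1%:R * n.+1%:R * th ^+ n / rho ^+ L.+1 +
          L.+1%:R / rho ^+ L.+1 * ((4 * L.+1%:R) ^+ n.+1 / (n.+1)`!%:R)
      <= M * expR (- (c * n.+1%:R))].
Proof.
move=> /andP[th0 th1] /andP[rho0 rho1].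
have ln2 : 0 < ln 2 :> R by rewrite ln_gt0// ltr1n.
pose t := - ln th; have t0 : 0 < t by rewrite oppr_gt0 ln_lt0// th0.
pose s := - ln rho; have s0 : 0 < s by rewrite oppr_gt0 ln_lt0// rho0.
have thE : th = expR (- t) by rewrite opprK lnK.
have rhoE k : (rho ^+ k)^-1 = expR (s * k%:R).
  by rewrite /s mulNr expRN expRM_natr lnK.
(* the summands give 2 s / d <= t / 2, 2 s / d <= 1 and 8 / d <= exp (- 3) *)
pose X := 4 * s / t + 2 * s + 8 * expR 3.
have st0 : 0 < 4 * s / t by rewrite divr_gt0 ?mulr_gt0.
have e30 : 0 < expR 3 :> R by exact: expR_gt0.
have X0 : 0 <= X by rewrite /X; lra.
have [d Xd] : exists d : nat, X < d%:R by exists (Num.bound X);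
  exact: archi_boundP.
pose dr : R := d%:R; rewrite -/dr in Xd.
have dr0 : 0 < dr by exact: le_lt_trans Xd.
have d0 : (0 < d)%N by rewrite -(ltr0n R).
pose c0 := Num.min (ln 2 / dr) (Num.min (t / 2) 1).
have c00 : 0 < c0 by rewrite !lt_min ?divr_gt0// ltr01.
have c01 : c0 <= ln 2 / dr by rewrite ge_min lexx.
have c02 : c0 <= t / 2 by rewrite !ge_min lexx orbT.
have c03 : c0 <= 1 by rewrite !ge_min lexx !orbT.
exists (c0 / 2), ((6 + 2 * expR t) * (8 / c0) ^+ 4), d; split.
- by rewrite divr_gt0.
- by rewrite mulr_gt0 ?exprn_gt0 ?divr_gt0// ltr_wpDr ?mulr_ge0 ?expR_ge0.
move=> n dn; exists (n.+1 %/ d)%N; set L := (n.+1 %/ d)%N.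
have F0 : 0 < (n.+1)`!%:R :> R by rewrite ltr0n fact_gt0.
have HF : n.+1%:R ^+ n.+1 / (n.+1)`!%:R <= expR n.+1%:R :> R.
  by apply: le_trans (expR_ge1Dxn n (ler0n _ _)); rewrite lerDr.
(* of F = (n+1)! only F > 0 and m ^ m / F <= exp m are used below *)
move: ((n.+1)`!%:R) F0 HF => F F0 HF.
pose l : R := L.+1%:R; pose m : R := n.+1%:R.
have dm : dr <= m by rewrite ler_nat leqW.
have m1 : 1 <= m by rewrite ler1n.
have l1 : 1 <= l by rewrite ler1n.
have dL : dr * l <= 2 * m.
  have : (d * L <= n.+1)%N by rewrite mulnC leq_divM.
  rewrite -(ler_nat R) natrM -/dr -/m => dL.
  by rewrite /l -natr1 mulrDr mulr1; lra.
have md : m <= dr * l.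
  rewrite /m /dr /l -natrM ler_nat mulnC ltnW// ltn_ceil//.
clearbody L.
have lm : l <= 2 * m.
  apply: le_trans dL; rewrite ler_peMl ?(le_trans ler01)//.
  by rewrite ler1n.
rewrite -/l -/m.
have sl : s * l <= t / 2 * m /\ s * l <= m.
  have H : s * (dr * l) <= s * (2 * m) by rewrite ler_wpM2l// ltW.
  split; rewrite -(ler_pM2l dr0).
    have H2 : 4 * s <= t * dr by rewrite [t * dr]mulrC -ler_pdivrMr//;
      rewrite /X in Xd; lra.
    have := ler_wpM2r (le_trans ler01 m1) H2; lra.
  have H2 : 2 * s <= dr by rewrite /X in Xd; lra.
  have := ler_wpM2r (le_trans ler01 m1) H2; lra.
pose E := expR (- (c0 * m)); have E0 : 0 < E by exact: expR_gt0.
have rl : (rho ^+ L.+1)^-1 = expR (s * l) by exact: rhoE.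
have B1 : (2 ^+ L.+1)^-1 <= E.
  rewrite -[in leLHS](@lnK R 2) ?posrE// -expRM_natr -expRN ler_expR lerN2.
  apply: (@le_trans _ _ (ln 2 / dr * m));
    first by rewrite ler_wpM2r// (le_trans ler01).
  rewrite -mulrA ler_wpM2l ?(ltW ln2)//.
  by rewrite mulrC ler_pdivrMr// mulrC.
have B2 : th ^+ n / rho ^+ L.+1 <= expR t * E.
  rewrite rl thE -expRM_natr -!expRD ler_expR.
  have -> : n%:R = m - 1 by rewrite /m -natr1 addrK.
  have : c0 * m <= t / 2 * m by rewrite ler_wpM2r// (le_trans ler01).
  have := sl.1; lra.
have B3 : (rho ^+ L.+1)^-1 * ((4 * l) ^+ n.+1 / F) <= E.
  rewrite rl.
  have H2 : (4 * l) ^+ n.+1 <= (8 / dr) ^+ n.+1 * m ^+ n.+1.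
    rewrite -exprMn lerXn2r ?nnegrE//; first by lra.
      by rewrite mulr_ge0 ?divr_ge0 ?(ltW dr0)// (le_trans ler01).
    by rewrite mulrAC ler_pdivlMr//; lra.
  have H3 : (8 / dr) ^+ n.+1 <= expR (- (3 * m)).
    rewrite -mulNr expRM_natr lerXn2r ?nnegrE ?expR_ge0//.
      by rewrite divr_ge0// ltW.
    rewrite ler_pdivrMr// expRN mulrC ler_pdivlMr//; rewrite /X in Xd; lra.
  apply: (@le_trans _ _ (expR m * (expR (- (3 * m)) * expR m))).
    have l40 : 0 <= (4 * l) ^+ n.+1 by rewrite exprn_ge0//; lra.
    apply: ler_pM; [exact: expR_ge0|by rewrite divr_ge0// ltW| |].
      by rewrite ler_expR; exact: sl.2.
    apply: (@le_trans _ _ ((8 / dr) ^+ n.+1 * (m ^+ n.+1 / F))).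
      by rewrite mulrA ler_wpM2r ?invr_ge0 ?(ltW F0).
    apply: ler_pM => //; first by rewrite exprn_ge0 ?divr_ge0 ?(ltW dr0).
    by rewrite divr_ge0 ?exprn_ge0 ?(ltW F0)//; lra.
  rewrite -!expRD ler_expR.
  have : c0 * m <= 1 * m by rewrite ler_wpM2r// (le_trans ler01).
  lra.
have m2 : 1 <= m ^+ 2 by rewrite exprn_ege1.
have m24 : m ^+ 2 <= m ^+ 4 by rewrite ler_weXn2l.
have m14 : m <= m ^+ 4 by rewrite -[leLHS]expr1 ler_weXn2l.
have lm2 : l ^+ 2 <= 4 * m ^+ 2.
  rewrite (_ : 4 * m ^+ 2 = (2 * m) ^+ 2); last by ring.
  by rewrite lerXn2r ?nnegrE//; lra.
have l0 : 0 <= l by lra.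
have m0 : 0 <= m by lra.
have ri0 : 0 <= (rho ^+ L.+1)^-1 by rewrite invr_ge0 exprn_ge0 ?(ltW rho0).
have S1 : l ^+ 2 * m ^+ 2 / 2 ^+ L.+1 <= 4 * (m ^+ 4 * E).
  rewrite (_ : 4 * _ = 4 * m ^+ 2 * m ^+ 2 * E); last by ring.
  apply: ler_pM => //; first by rewrite mulr_ge0 ?exprn_ge0.
  by rewrite ler_wpM2r ?exprn_ge0.
have S2 : l * m * th ^+ n / rho ^+ L.+1 <= 2 * expR t * (m ^+ 4 * E).
  rewrite (_ : 2 * _ * _ = 2 * m ^+ 4 * (expR t * E)); last by ring.
  rewrite -[leLHS]mulrA; apply: ler_pM => //; first by rewrite mulr_ge0.
    by rewrite mulr_ge0 ?exprn_ge0 ?(ltW th0).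
  apply: (@le_trans _ _ (2 * m * m)); first by rewrite ler_wpM2r.
  by rewrite -mulrA -expr2 ler_wpM2l.
have S3 : l / rho ^+ L.+1 * ((4 * l) ^+ n.+1 / F) <= 2 * (m ^+ 4 * E).
  rewrite -[leLHS]mulrA [leRHS]mulrA; apply: ler_pM => //.
    by rewrite mulr_ge0// divr_ge0 ?exprn_ge0 ?(ltW F0)// mulr_ge0.
  by apply: (le_trans lm); rewrite ler_wpM2l.
have S4 : m ^+ 4 * E <= (8 / c0) ^+ 4 * expR (- (c0 / 2 * m)).
  have H : m <= 8 / c0 * expR (c0 / 8 * m).
    rewrite mulrAC ler_pdivlMr//.
    have := expR_ge1Dx (c0 / 8 * m); lra.
  apply: (@le_trans _ _ ((8 / c0 * expR (c0 / 8 * m)) ^+ 4 * E)).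
    by rewrite ler_wpM2r ?(ltW E0)// lerXn2r ?nnegrE// (le_trans m0 H).
  rewrite (_ : _ * E = (8 / c0) ^+ 4 * (expR (4 * (c0 / 8 * m)) * E));
    last first.
    by rewrite expRM_natl; ring.
  rewrite -expRD; apply: ler_wpM2l.
    by rewrite exprn_ge0// divr_ge0// ltW.
  by rewrite ler_expR; lra.
have S5 := ler_wpM2l (ltW (expR_gt0 t)) S4.
have -> : (6 + 2 * expR t) * (8 / c0) ^+ 4 * expR (- (c0 / 2 * m)) =
  6 * ((8 / c0) ^+ 4 * expR (- (c0 / 2 * m))) +
    2 * (expR t * ((8 / c0) ^+ 4 * expR (- (c0 / 2 * m)))) by ring.
move: S1 S2 S3 S4 S5; rewrite -[2 * expR t * _]mulrA.
set y1 := m ^+ 4 * E; set y2 := expR t * y1.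
set y3 := _ * expR (- (c0 / 2 * m)); set y4 := expR t * y3.
set z1 := l ^+ 2 * _ / _; set z2 := _ / rho ^+ _; set z3 := _ * (_ / _) => *;
  lra.
Qed.
End Convergence.

Theorem theorem1 (R : realType) (f : R -> R) (x0 : R)
    (f_loc : locally_integrable `]0, +oo[ f)
    (f_laplace : forall z : R, 0 < z -> laplace f z \is a fin_num)
    (x0_gt0 : 0 < x0)
    (f_analytic : \forall y \near x0, analytic_at f y) :
  exists2 c : R, 0 < c &
    (fun n : nat => gaver_stehfest f n x0) =
      (fun=> f x0) +O_\oo (fun n : nat => expR (- (c * n%:R))).
Proof.
have [th [rho [A [th01 rho01 A0 H]]]] :=
  gaver_stehfest_error_terms f x0 f_loc f_laplace x0_gt0
  (nbhs_singleton f_analytic).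
have [c [M [d [c0 M0 HM]]]] := error_terms_decay _ _ th01 rho01.
exists c => //; apply/eqaddOP; exists (A * M); split; first exact: num_real.
move=> k kA; exists d.+1 => // -[//|n] /= dn.
rewrite !fctE (ger0_norm (expR_ge0 _)).
have [L HL] := HM n dn.
apply: (le_trans (H n L)).
apply: (@le_trans _ _ (A * M * expR (- (c * n.+1%:R)))).
  by rewrite -[leRHS]mulrA ler_wpM2l ?(ltW A0).
by rewrite ler_wpM2r ?expR_ge0// ltW.
Qed.
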